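(* Let $p\in(1,\infty)$ and for $m\in\mathbb{N}$ let $$\Psi_m^{D,1}(x_1,x_2)=\psi_m^D(x_1)\varphi_m^D(x_2),\quad \Psi_m^{D,2}(x_1,x_2)=\varphi_m^D(x_1)\psi_m^D(x_2),\quad \Psi_m^{D,3}(x_1,x_2)=\psi_m^D(x_1)\psi_m^D(x_2).$$ Then, for $k=(k_1,k_2)\in\mathbb{Z}^2$, $$\lim_{m\to\infty}C_{k,p}(\Psi_m^{D,1})=\pi^{-k_1}\left(\frac{1-2^{1-pk_1}}{pk_1-1}\right)^{1/p}\frac{\pi^{-k_2}}{(1-pk_2)^{1/p}}\quad\text{if }k_2\le 1/p,\ k_1\in\mathbb{N},$$ $$\lim_{m\to\infty}C_{k,p}(\Psi_m^{D,2})=\pi^{-k_2}\left(\frac{1-2^{1-pk_2}}{pk_2-1}\right)^{1/p}\frac{\pi^{-k_1}}{(1-pk_1)^{1/p}}\quad\text{if }k_1\le 1/p,\ k_2\in\mathbb{N},$$ $$\lim_{m\to\infty}C_{k,p}(\Psi_m^{D,3})=\pi^{-k_1-k_2}\left(\frac{1-2^{1-pk_1}}{pk_1-1}\cdot\frac{1-2^{1-pk_2}}{pk_2-1}\right)^{1/p}\quad\text{if }(k_1,k_2)\in\mathbb{N}^2.$$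
   Context: The Fourier transform on $\mathbb{R}$ is $\widehat f(\omega)=\frac{1}{\sqrt{2\pi}}\int_{\mathbb{R}}f(x)e^{-i x\omega}\,dx$, with the corresponding (tensor product) transform on $\mathbb{R}^2$; $\|\cdot\|_p$ is the $L_p$ norm; $\mathbb{N}$ is the set of positive integers. For $\omega=(\omega_1,\omega_2)\in\mathbb{R}^2$ and $k=(k_1,k_2)\in\mathbb{Z}^2$, $(i\omega)^k=(i\omega_1)^{k_1}(i\omega_2)^{k_2}$, and ${}_kf$ is the function with $\widehat{{}_kf}(\omega)=(i\omega)^{-k}\widehat f(\omega)$. For $1<p,p'<\infty$ with $1/p+1/p'=1$, $$C_{k,p}(\Psi)=\sup_{f\in\mathcal{A}_k^{p'}}\frac{|\langle f,\Psi\rangle|}{\|\widehat\Psi\|_p}=\frac{\|\widehat{{}_k\Psi}\|_p}{\|\widehat\Psi\|_p},\qquad\mathcal{A}_k^{p'}=\{f\in L_{p'}(\mathbb{R}^2):\|(i\omega)^k\widehat f(\omega)\|_{p'}\le1\};$$ the last ratio is the working definition. $H_m$ is the Daubechies orthonormal low-pass mask of order $m$: a $2\pi$-periodic trigonometric polynomial $H_m(t)=\sum_{\nu=0}^L h_\nu e^{-i\nu t}$ with $$|H_m(t)|^2=1-c_m\int_0^t\sin^{2m-1}\omega\,d\omega,\qquad c_m=\left(\int_0^\pi\sin^{2m-1}\omega\,d\omega\right)^{-1}$$ (equivalently $|H_m(t)|^2=\cos^{2m}(t/2)\sum_{\nu=0}^{m-1}\binom{m-1+\nu}{\nu}\sin^{2\nu}(t/2)$),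 normalized by $H_m(0)=1$. The Daubechies orthonormal scaling function and wavelet of order $m$ are given by $\widehat{\varphi_m^D}(\omega)=\frac{1}{\sqrt{2\pi}}\prod_{\ell=1}^\infty H_m(2^{-\ell}\omega)$ and $\widehat{\psi_m^D}(\omega)=\frac{1}{\sqrt{2\pi}}H_m(\omega/2+\pi)\prod_{\ell=1}^\infty H_m(2^{-\ell-1}\omega)$. *)

(* Defs.v *)
From HB Require Import structures.
From mathcomp Require Import all_boot all_order all_algebra.
From mathcomp Require Import complex.
From mathcomp Require Import all_classical all_reals all_analysis.

Set Implicit Arguments.
Unset Strict Implicit.
Unset Printing Implicit Defensive.

Import Order.TTheory GRing.Theory Num.Theory.
Import numFieldNormedType.Exports.

Local Open Scope classical_set_scope.
Local Open Scope complex_scope.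
Local Open Scope ring_scope.

Section ComplexAnalysis.
Context {R : realType}.

Definition cmod (z : R[i]) : R := Normc.normc z.

(* expi t is e ^ (i t). *)
Definition expi (t : R) : R[i] := cos t +i* sin t.

Definition cintegrable d (T : measurableType d)
    (mu : {measure set T -> \bar R}) (f : T -> R[i]) : Prop :=
  mu.-integrable setT (fun x => (complex.Re (f x))%:E) /\
  mu.-integrable setT (fun x => (complex.Im (f x))%:E).

Definition cintegral d (T : measurableType d)
    (mu : {measure set T -> \bar R}) (f : T -> R[i]) : R[i] :=
  (\int[mu]_x complex.Re (f x)) +i* (\int[mu]_x complex.Im (f x)).

(* The integral from a to b, oriented so that it changes sign when a and b are
   exchanged. *)
Definition ointegral (a b : R) (f : R -> R) : R :=
  if a <= b then \int[lebesgue_measure]_(x in `[a, b]) f x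
  else - \int[lebesgue_measure]_(x in `[b, a]) f x.

(* The product of F l over all l >= 1.  The topology of R[i] is the one its
   modulus induces on the regular module R[i]^o. *)
Definition infprod (F : nat -> R[i]) : R[i] :=
  lim ((\prod_(1 <= l < n.+1) F l : R[i]^o) @[n --> \oo]).

End ComplexAnalysis.

Section Fourier.
Context {R : realType}.

Definition lebesgue1 : {measure set (measurableTypeR R) -> \bar R} :=
  @lebesgue_measure R.

Definition lebesgue2 :
    {measure set (measurableTypeR R * measurableTypeR R) -> \bar R} :=
  (@lebesgue_measure R \x @lebesgue_measure R)%E.

Definition fourier1 (f : R -> R[i]) (w : R) : R[i] :=
  ((Num.sqrt (2 * pi))^-1)%:C *
  cintegral lebesgue1 (fun x => f x * expi (- (x * w))).

Definition fourier2 (f : R * R -> R[i]) (w : R * R) : R[i] :=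
  ((Num.sqrt (2 * pi))^-1 ^+ 2)%:C *
  cintegral lebesgue2
    (fun x => f x * expi (- (x.1 * w.1 + x.2 * w.2))).

Definition LpnormC (p : R) (f : R * R -> R[i]) : \bar R :=
  ('N[lebesgue2]_(p%:E)[EFin \o (cmod \o f)])%E.

(* (i w) ^ k for an integer multi-index k.  It is 0 instead of undefined when
   some k_j < 0 and w_j = 0, on a set of measure zero. *)
Definition ipow (w : R * R) (k : int * int) : R[i] :=
  (0 +i* w.1) ^ k.1 * (0 +i* w.2) ^ k.2.

(* The Fourier transform of the function written _k f, the k-th primitive of f
   (a derivative in the directions where k_j < 0). *)
Definition fourier2_prim (k : int * int) (f : R * R -> R[i]) (w : R * R)
    : R[i] :=
  ipow w (- k.1, - k.2) * fourier2 f w.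

(* The value is +oo when the numerator is infinite and the denominator is
   finite. *)
Definition Ckp (k : int * int) (p : R) (f : R * R -> R[i]) : \bar R :=
  (LpnormC p (fourier2_prim k f) / LpnormC p (fourier2 f))%E.

End Fourier.

Section Daubechies.
Context {R : realType}.

Definition sinpow (m : nat) (x : R) : R := sin x ^+ (2 * m).-1.

(* Spectral factorization does not determine a mask uniquely: every
   trigonometric polynomial with the prescribed squared modulus is allowed. *)
Definition is_daubechies_mask (m : nat) (H : R -> R[i]) : Prop :=
  [/\ exists (L : nat) (h : nat -> R[i]), forall t,
        H t = \sum_(0 <= nu < L.+1) h nu * expi (- (nu%:R * t)),
      forall t, cmod (H t) ^+ 2 =
        1 - (ointegral 0 pi (sinpow m))^-1 * ointegral 0 t (sinpow m)
    & H 0 = 1].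

(* Scaling functions and wavelets are compactly supported and in L_2, hence in
   L_1, so that their Fourier transforms are Lebesgue integrals. *)
Definition is_scaling_function (H : R -> R[i]) (phi : R -> R[i]) : Prop :=
  cintegrable lebesgue1 phi /\
  forall w, fourier1 phi w =
    ((Num.sqrt (2 * pi))^-1)%:C * infprod (fun l => H (2 ^- l * w)).

Definition is_wavelet (H : R -> R[i]) (psi : R -> R[i]) : Prop :=
  cintegrable lebesgue1 psi /\
  forall w, fourier1 psi w =
    ((Num.sqrt (2 * pi))^-1)%:C * H (w / 2 + pi) *
    infprod (fun l => H (2 ^- l.+1 * w)).

Definition tensor (f g : R -> R[i]) (x : R * R) : R[i] := f x.1 * g x.2.

End Daubechies.

(* Main.v *)
(* With [G' = (X (2 - X)) ^ n] and [G(0) = 0], the squared mask of order [n + 1]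
   is [M(t) = 1 - G(1 - cos t) / G(2)].  Comparing derivatives gives
   [G(y) <= y (y (2 - y)) ^ n G(1)] on [0, 1], so [M] tends to 1 where [cos > 0]
   and to 0 where [cos < 0], and for every [N] one has
   [M(t) <= (3 / 2 (1 + cos t)) ^ N] as soon as [n >= 2 N].  Since
   [1 + cos t] is [2 cos (t / 2) ^ 2], the product of these bounds over the
   dyadic scales telescopes; as [3 / 4 < 1], the transforms of the scaling
   functions decay faster than any fixed power of the frequency, uniformly in
   [n].  The moduli of the transforms converge almost everywhere to the
   indicators of [|w| < pi] and [pi < |w| < 2 pi], and dominated convergence
   together with Tonelli's theorem for the tensor products reduces the limits
   to integrals of powers. *)
Require Import Defs.
From HB Require Import structures.
From mathcomp Require Import all_boot all_order all_algebra.
From mathcomp Require Import complex polyrcf ring lra.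
From mathcomp Require Import all_classical all_reals all_analysis.
From mathcomp Require Import measurable_realfun.

Set Implicit Arguments.
Unset Strict Implicit.
Unset Printing Implicit Defensive.

Import Order.TTheory GRing.Theory Num.Theory.
Import numFieldNormedType.Exports.

Local Open Scope classical_set_scope.
Local Open Scope ring_scope.

(** * The squared modulus of the mask *)

Section MaskPrimitive.
Context {R : realType}.
Implicit Types (n N : nat) (x y t : R).

(** Only [|H|^2] is prescribed, and [Ckp] sees Fourier transforms through their moduli alone, so
    every estimate is made on [M]; the phases of [H] intervene only in the convergence of the
    complex product. In the variable [1 - cos t] the squared mask is a polynomial, and comparisons
    reduce to polynomial inequalities with constants independent of [n]. The obstacle is an
    integrable majorant common to all large orders. A component [k_j < 0] gives a weight growing at
    infinity, which the decay of the transform must beat; a component [k_j > 0] gives a weight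
    singular at the origin, which only the flatness of the wavelet transform there can absorb. Both
    come from the same mask bound, whose exponent [N] is free at the price of dropping finitely many
    orders. The scaling function never meets a singular weight, since an integer at most [1 / p < 1]
    is at most 0. Convergence to 1 on [|w| < pi] concerns infinitely many factors at once. Convexity
    of [G] on [0, 1] makes [1 - M] at least halve with the angle, so that the first factor controls
    the whole product. *)

Definition bump n : {poly R} := ('X * (2%:P - 'X)) ^+ n.

(** The antiderivative is taken coefficientwise. At index 0 the division is by [0%:R], whose inverse
    is 0, so the constant term vanishes. *)
Definition bump_prim n : {poly R} :=
  \poly_(i < (size (bump n)).+1) ((bump n)`_i.-1 / i%:R).

Lemma horner_bump n x : (bump n).[x] = (x * (2 - x)) ^+ n.
Proof. by rewrite /bump !hornerE. Qed.

Lemma bump_prim0 n : (bump_prim n).[0] = 0.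
Proof. by rewrite horner_coef0 coef_poly /= invr0 mulr0. Qed.

Lemma deriv_bump_prim n : (bump_prim n)^`() = bump n.
Proof.
apply/polyP => i; rewrite coef_deriv coef_poly ltnS.
case: ltnP => [_|/leq_sizeP/(_ _ (leqnn i)) ->]; last by rewrite mul0rn.
by rewrite -[LHS]mulr_natr -mulrA mulVf ?mulr1// pnatr_eq0.
Qed.

Lemma le_bump_prim n :
  {in `[0, 2] &, {homo (horner (bump_prim n)) : x y / x <= y}}.
Proof.
apply: ler_hornerW => x; rewrite in_itv/= => /andP[x0 x2].
by rewrite deriv_bump_prim horner_bump exprn_ge0// mulr_ge0 ?subr_ge0// ltW.
Qed.

Lemma bump_prim_gt0 n : 0 < (bump_prim n).[1].
Proof.
rewrite -(bump_prim0 n); apply: (@ltr_hornerW _ (bump_prim n) 0 1) => //.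
- move=> x; rewrite in_itv/= => /andP[x0 x1].
  by rewrite deriv_bump_prim horner_bump exprn_gt0// mulr_gt0// subr_gt0; lra.
- by rewrite in_itv/= lexx ler01.
- by rewrite in_itv/= lexx ler01.
Qed.

(** The integrand is invariant under [x -> 2 - x], so [G(2 - x) + G(x)] has zero derivative; its
    value at 0 is [G(2)]. *)
Lemma bump_prim_sym n x :
  (bump_prim n).[2 - x] = (bump_prim n).[2] - (bump_prim n).[x].
Proof.
pose q := bump_prim n \Po (2%:P - 'X) + bump_prim n.
have dq y : (q^`()).[y] = 0.
  rewrite /q derivD deriv_comp deriv_bump_prim !poly.derivE sub0r !hornerE.
  rewrite horner_comp !horner_bump !hornerE.
  rewrite (_ : (2 - y) * (2 - (2 - y)) = y * (2 - y)); ring.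
have : q.[x] = q.[0].
  have cst a b : a < b -> q.[a] = q.[b].
    move=> /(poly_mvt q)[c _]; rewrite dq mul0r => /eqP.
    by rewrite subr_eq0 => /eqP.
  by case: (ltgtP x 0) => [/cst//|/cst/esym//|->].
rewrite /q !hornerE !horner_comp !hornerE bump_prim0 subr0 addr0 => <-.
by rewrite addrK.
Qed.

Lemma bump_prim2 n : (bump_prim n).[2] = 2 * (bump_prim n).[1].
Proof.
have := bump_prim_sym n 1; rewrite (_ : 2 - 1 = 1); last by lra.
by move=> /eqP; rewrite eq_sym subr_eq => /eqP ->; rewrite mulr_natl mulr2n.
Qed.

(* Both [s |-> k G(s)] and [s |-> G(y s)] vanish at 0, so it is enough to
   compare their derivatives. *)
Lemma bump_prim_scale n (k y x : R) : 0 <= x ->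
  (forall s : R, 0 < s < x ->
    y * (y * s * (2 - y * s)) ^+ n <= k * (s * (2 - s)) ^+ n) ->
  (bump_prim n).[y * x] <= k * (bump_prim n).[x].
Proof.
move=> x0 H.
pose q := k *: bump_prim n - (bump_prim n \Po (y *: 'X)).
have : q.[0] <= q.[x].
  apply: (@ler_hornerW _ 0 x) => //; rewrite ?in_itv/= ?lexx ?x0// => s sx.
  have -> : (q^`()).[s] =
      k * (s * (2 - s)) ^+ n - y * (y * s * (2 - y * s)) ^+ n.
    rewrite /q derivB derivZ deriv_comp deriv_bump_prim !poly.derivE.
    rewrite !hornerE horner_comp !horner_bump !hornerE/= mulr1.
    by rewrite [X in _ - X]mulrC.
  by rewrite subr_ge0; apply: H; move: sx; rewrite in_itv.
by rewrite /q !hornerE !horner_comp !hornerE bump_prim0 mulr0 subrr subr_ge0.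
Qed.

(** [G'] increases on [0, 1] and [G(0) = 0], so [G] is convex there and its graph lies below its
    chords from the origin. *)
Lemma bump_prim_half n x : 0 <= x <= 1 ->
  (bump_prim n).[x / 2] <= (bump_prim n).[x] / 2.
Proof.
move=> /andP[x0 x1]; rewrite mulrC [leRHS]mulrC.
apply: bump_prim_scale => // s /andP[s0 sx].
rewrite ler_pM2l ?invr_gt0//; apply: lerXn2r; rewrite ?nnegrE; nra.
Qed.

Lemma bump_prim_le n y : 0 <= y <= 1 ->
  (bump_prim n).[y] <= y * (y * (2 - y)) ^+ n * (bump_prim n).[1].
Proof.
move=> /andP[y0 y1]; rewrite -[in leLHS](mulr1 y).
apply: bump_prim_scale => // s /andP[s0 s1].
rewrite -[leRHS]mulrA; apply: ler_wpM2l => //; rewrite -exprMn.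
apply: lerXn2r; rewrite ?nnegrE.
- by rewrite !mulr_ge0 ?subr_ge0//; nra.
- by rewrite !mulr_ge0 ?subr_ge0//; nra.
(* After the common factor [y s] is removed, the difference [(2 - y)(2 - s) - (2 - y s)] equals
   [2 (1 - y)(1 - s)]. *)
have -> : y * (2 - y) * (s * (2 - s)) = y * s * ((2 - y) * (2 - s)) by ring.
by apply: ler_wpM2l; [rewrite mulr_ge0// ltW | nra].
Qed.

(* The squared modulus of the Daubechies mask of order [n.+1]: the substitution
   [x = 1 - cos u] turns the integral of [sin ^ (2 n + 1)] over [0, t] into
   [(bump_prim n).[1 - cos t]]. *)
Definition dmask n t : R := 1 - (bump_prim n).[1 - cos t] / (bump_prim n).[2].

End MaskPrimitive.

Section SquaredMask.
Context {R : realType}.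
Implicit Types (n N : nat) (x y t w : R).

Lemma bump_prim2_gt0 n : 0 < (bump_prim n).[2] :> R.
Proof. by rewrite bump_prim2 mulr_gt0 ?bump_prim_gt0. Qed.

Lemma onem_dmask n t :
  1 - dmask n t = (bump_prim n).[1 - cos t] / (bump_prim n).[2].
Proof. by rewrite /dmask subKr. Qed.

(** The conjugate quadrature identity of orthonormal masks. Through it, nonnegativity and
    convergence to 1 follow from upper bounds at [t + pi]. *)
Lemma dmaskDpi n t : dmask n (t + pi) = 1 - dmask n t.
Proof.
rewrite onem_dmask /dmask cosDpi opprK.
have -> : 1 + cos t = 2 - (1 - cos t) by ring.
rewrite bump_prim_sym mulrBl divff ?subKr// gt_eqF// bump_prim2_gt0//.
Qed.

Lemma dmask_le1 n t : dmask n t <= 1.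
Proof.
rewrite -subr_ge0 onem_dmask divr_ge0 ?(ltW (bump_prim2_gt0 n))//.
rewrite -[leLHS](bump_prim0 n) le_bump_prim// ?in_itv/=; have := cos_le1 t;
  have := cos_geN1 t; lra.
Qed.

Lemma dmask_ge0 n t : 0 <= dmask n t.
Proof. by have := dmask_le1 n (t + pi); rewrite dmaskDpi lerBlDl lerDr. Qed.

Lemma dmask_le_bump n t : cos t <= 0 ->
  dmask n t <= (1 + cos t) * ((1 + cos t) * (1 - cos t)) ^+ n.
Proof.
move=> ct0; have -> : dmask n t = 1 - dmask n (t + pi).
  by rewrite dmaskDpi subKr.
have H : 0 <= 1 + cos t <= 1 by have := cos_geN1 t; lra.
rewrite onem_dmask cosDpi opprK ler_pdivrMr ?bump_prim2_gt0// bump_prim2.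
apply: le_trans (bump_prim_le n H) _.
have -> : 2 - (1 + cos t) = 1 - cos t by ring.
rewrite mulrCA ler_peMl//; last by rewrite ler1n.
rewrite mulr_ge0 ?(ltW (bump_prim_gt0 n))// mulr_ge0 ?exprn_ge0//; nra.
Qed.

(* On [0, 1], [(y (2 - y)) ^ 2 <= 3 y / 2]. *)
Lemma dmask_le_cos n N t : (N.*2 <= n)%N ->
  dmask n t <= (3 / 2 * (1 + cos t)) ^+ N.
Proof.
move=> nN; have [ct0|ct0] := lerP (cos t) 0.
  have c1 := cos_geN1 t; set y := 1 + cos t.
  have y0 : 0 <= y by rewrite /y; lra.
  have y1 : y <= 1 by rewrite /y; lra.
  apply: le_trans (dmask_le_bump n ct0) _; rewrite -/y.
  have -> : 1 - cos t = 2 - y by rewrite /y; ring.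
  have z0 : 0 <= y * (2 - y) by nra.
  have z1 : y * (2 - y) <= 1 by nra.
  apply: (@le_trans _ _ ((y * (2 - y)) ^+ n)).
    by rewrite ler_piMl// exprn_ge0.
  apply: (@le_trans _ _ ((y * (2 - y)) ^+ N.*2)).
    by apply: ler_wiXn2l.
  rewrite -mul2n exprM; apply: lerXn2r; rewrite ?nnegrE; [nra|nra|].
  rewrite exprMn expr2 -mulrA mulrC; apply: ler_wpM2r => //.
  (* This product is [32 / 27 - y (2 - y) ^ 2], the maximum being attained at [y = 2 / 3]. The
     constant [3 / 2] lies above [32 / 27] and below 2; the latter makes the ratio [3 / 4] per
     dyadic scale smaller than 1. *)
  have : 0 <= (y - 2 / 3) ^+ 2 * (8 / 3 - y).
    by rewrite mulr_ge0 ?sqr_ge0//; lra.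
  by lra.
apply: le_trans (dmask_le1 n t) _; apply: exprn_ege1; lra.
Qed.

Lemma cvg_dmask0 t : cos t < 0 -> dmask n t @[n --> \oo] --> (0 : R).
Proof.
move=> ct0; have c1 := cos_geN1 t; set y := 1 + cos t.
have y0 : 0 <= y by rewrite /y; lra.
have y1 : y < 1 by rewrite /y; lra.
apply: (@squeeze_cvgr _ _ _ _ (cst 0) (fun n => (y * (1 - cos t)) ^+ n)).
- apply: nearW => n; rewrite dmask_ge0/=.
  apply: le_trans (dmask_le_bump n (ltW ct0)) _.
  by rewrite ler_piMl ?exprn_ge0 ?mulr_ge0// ?subr_ge0 ?(ltW y1)//; lra.
- exact: cvg_cst.
- by apply: cvg_expr; rewrite ger0_norm /y; nra.
Qed.

(** With [c = cos (t / 2)] nonnegative, [1 - cos t = 2 (1 - c)(1 + c)] is at least [2 (1 - c)].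
    Monotonicity of [G] and its convexity on [0, 1] then give the factor [1 / 2], uniformly in
    [n]. *)
Lemma onem_dmask_half n t : 0 <= cos t -> 0 <= cos (t / 2) ->
  1 - dmask n (t / 2) <= (1 - dmask n t) / 2.
Proof.
move=> c0 ch0.
have E : cos t = cos (t / 2) ^+ 2 *+ 2 - 1.
  by rewrite -cos_mulr2n; congr cos; lra.
rewrite !onem_dmask mulrAC ler_wpM2r ?invr_ge0 ?(ltW (bump_prim2_gt0 n))//.
have := cos_le1 t; have := cos_le1 (t / 2) => h1 h2.
apply: le_trans (bump_prim_half n _); last by lra.
by apply: le_bump_prim; rewrite ?in_itv/=; nra.
Qed.

Lemma continuous_dmask n : continuous (@dmask R n).
Proof.
move=> t; apply: cvgB; first exact: cvg_cst.
apply: cvgMl.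
apply: (@continuous_comp _ _ _ (fun t => 1 - cos t) (horner (bump_prim n))).
  by apply: cvgB; [exact: cvg_cst|exact: continuous_cos].
exact: continuous_horner.
Qed.

Lemma is_derive_bump_prim_cos n t :
  is_derive t 1 (fun t : R => (bump_prim n).[1 - cos t]) (sinpow n.+1 t).
Proof.
have dcos : is_derive t 1 (fun t : R => 1 - cos t) (sin t).
  by apply: (trigger_derive (is_deriveB _ _)); rewrite sub0r opprK.
have D := @is_derive1_comp R (horner (bump_prim n)) (fun t => 1 - cos t) t _ _
  (is_derive_poly (bump_prim n) (1 - cos t)) dcos.
apply: (trigger_derive D).
rewrite deriv_bump_prim horner_bump /sinpow mulnS addSn/= add1n.
rewrite exprS exprM sin2cos2 [LHS]mulrC; congr (_ * _ ^+ _).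
by ring.
Qed.

Lemma continuous_sinpow n : continuous (@sinpow R n).
Proof. move=> t; apply: (@continuous_comp _ _ _ sin (@GRing.exp R ^~ _)).
  exact: continuous_sin.
exact: exprn_continuous. Qed.

Lemma Rintegral_sinpow n (a b : R) : a <= b ->
  \int[@lebesgue_measure R]_(x in `[a, b]) sinpow n.+1 x =
  (bump_prim n).[1 - cos b] - (bump_prim n).[1 - cos a].
Proof.
rewrite le_eqVlt => /predU1P[<-|ab].
  by rewrite set_itv1 Rintegral_set1 subrr.
pose F t : R := (bump_prim n).[1 - cos t].
have cF : continuous F.
  move=> t; apply/differentiable_continuous/derivable1_diffP.
  by have [] := is_derive_bump_prim_cos n t.
rewrite /Rintegral (@continuous_FTC2 _ _ F)//.
- by apply: continuous_subspaceT; exact: continuous_sinpow.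
- split; [by move=> x _; have [] := is_derive_bump_prim_cos n x| |].
  + by apply: cvg_at_right_filter; exact: cF.
  + by apply: cvg_at_left_filter; exact: cF.
- by move=> x _; rewrite derive1E; have [_] := is_derive_bump_prim_cos n x.
Qed.

Lemma ointegral_sinpow n t :
  ointegral 0 t (sinpow n.+1) = (bump_prim n).[1 - cos t].
Proof.
rewrite /ointegral; case: ifPn => [t0|]; last rewrite -ltNge => /ltW t0.
  by rewrite Rintegral_sinpow// cos0 subrr bump_prim0 subr0.
by rewrite Rintegral_sinpow// cos0 subrr bump_prim0 sub0r opprK.
Qed.

Lemma daubechies_mask_dmask n (H : R -> R[i]) t :
  is_daubechies_mask n.+1 H -> cmod (H t) ^+ 2 = dmask n t.
Proof.
move=> [_ -> _]; rewrite !ointegral_sinpow cospi opprK mulrC.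
by rewrite (_ : 1 + 1 = 2).
Qed.

End SquaredMask.

(** * Elementary estimates, complex moduli and convergence of complex sequences *)

Section Preliminaries.
Context {R : realType}.
Implicit Types s t w : R.

Lemma norm_sin_le s : `|sin s| <= `|s|.
Proof.
wlog s0 : s / 0 <= s.
  move=> H; have [/H//|/ltW s0] := leP 0 s.
  by rewrite -normrN -sinN -[leRHS]normrN H// oppr_ge0.
have [|c _] := @MVT_segment R sin cos 0 s s0 (fun x _ => is_derive_sin x).
  by apply: continuous_subspaceT; exact: continuous_sin.
by rewrite sin0 !subr0 => ->; rewrite normrM ler_piMl// cos_max.
Qed.

Lemma onem_cos_le s : 1 - cos s <= s ^+ 2 / 2.
Proof.
have -> : cos s = cos ((s / 2) *+ 2) by congr cos; lra.
rewrite cos_mulr2n cos2sin2.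
have : sin (s / 2) ^+ 2 <= (s / 2) ^+ 2
  by rewrite -[leLHS]real_normK ?num_real//
    -[leRHS]real_normK ?num_real// lerXn2r ?nnegrE ?norm_sin_le.
by lra.
Qed.

Lemma onem_cos_le_norm s : 1 - cos s <= `|s|.
Proof.
have := onem_cos_le s; rewrite -[s ^+ 2]real_normK ?num_real//.
have s0 := normr_ge0 s; have c1 := cos_geN1 s => h.
by have [s2|s2] := lerP `|s| 2; nra.
Qed.

Lemma cvgn_geometric_increments (u : R^nat) (C : R) :
  (forall k, `|u k.+1 - u k| <= C / 2 ^+ k) -> cvgn u.
Proof.
move=> uC.
have : cvgn (series (telescope u)).
  apply: normed_cvg; apply: (@series_le_cvg _ _ (geometric C 2^-1)).
  - by move=> k; rewrite /= normr_ge0.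
  - by move=> k; rewrite /= exprVn (le_trans _ (uC k)).
  - by move=> k; rewrite /= exprVn; exact: uC.
  - by apply: is_cvg_geometric_series; rewrite ger0_norm ?invf_lt1 ?ltr1n.
rewrite telescopeK => cu; apply/cvg_ex.
exists (limn [sequence u n - u 0%N]_n + u 0%N).
rewrite [X in X @ _](_ : u = (fun n => [sequence u n - u 0%N]_n n + u 0%N));
  last first.
  by apply/funext => n /=; rewrite subrK.
by apply: cvgD; [exact: cu|exact: cvg_cst].
Qed.

End Preliminaries.

Section ComplexModulus.
Context {R : realType}.
Implicit Types (z : R[i]) (t : R).

Lemma cmodM z z' : cmod (z * z') = cmod z * cmod z'.
Proof. exact: Normc.normcM. Qed.

Lemma cmod_ge0 z : 0 <= cmod z.
Proof. by case: z => a b; rewrite /cmod /= sqrtr_ge0. Qed.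

Lemma cmod_prod (I : Type) (r : seq I) (F : I -> R[i]) :
  cmod (\prod_(i <- r) F i) = \prod_(i <- r) cmod (F i).
Proof.
by apply: (big_morph cmod cmodM); rewrite /cmod Normc.normc1.
Qed.

Lemma cmod_sum_le (I : Type) (r : seq I) (F : I -> R[i]) :
  cmod (\sum_(i <- r) F i) <= \sum_(i <- r) cmod (F i).
Proof.
elim/big_rec2: _ => [|i x y _ xy]; first by rewrite /cmod Normc.normc0.
by rewrite (le_trans (le_normcD _ _))// lerD2l.
Qed.

Lemma cmodC (x : R) : cmod x%:C%C = `|x|.
Proof. by rewrite /cmod /= expr0n addr0 sqrtr_sqr. Qed.

Lemma norm_Re_le z : `|complex.Re z| <= cmod z.
Proof.
by case: z => a b; rewrite /cmod /= -sqrtr_sqr ler_wsqrtr// lerDl sqr_ge0.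
Qed.

Lemma norm_Im_le z : `|complex.Im z| <= cmod z.
Proof.
by case: z => a b; rewrite /cmod /= -sqrtr_sqr ler_wsqrtr// lerDr sqr_ge0.
Qed.

Lemma cmod_le_ReIm z : cmod z <= `|complex.Re z| + `|complex.Im z|.
Proof.
case: z => a b; rewrite /cmod /=.
rewrite -[leRHS]ger0_norm ?addr_ge0// -sqrtr_sqr ler_wsqrtr//.
have h := mulr_ge0 (normr_ge0 a) (normr_ge0 b).
rewrite -(real_normK (num_real a)) -(real_normK (num_real b)); nra.
Qed.

Lemma cmod_sqr z : cmod z ^+ 2 = complex.Re z ^+ 2 + complex.Im z ^+ 2.
Proof. by case: z => a b; rewrite /cmod /= sqr_sqrtr// addr_ge0 ?sqr_ge0. Qed.

Lemma normCE z : `|z : R[i]^o| = (cmod z)%:C%C.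
Proof. by case: z. Qed.

Lemma cmod_expi_sub1 t : cmod (expi t - 1) <= 2 * `|t|.
Proof.
rewrite (le_trans (cmod_le_ReIm _))// /expi /= oppr0 addr0 mulr_natl mulr2n.
rewrite lerD ?norm_sin_le// distrC ger0_norm ?subr_ge0 ?cos_le1//.
exact: onem_cos_le_norm.
Qed.

Lemma cvgn_complex (u : nat -> R[i]) (a b : R) :
  complex.Re (u n) @[n --> \oo] --> a -> complex.Im (u n) @[n --> \oo] --> b ->
  (u n : R[i]^o) @[n --> \oo] --> ((a +i* b)%C : R[i]^o).
Proof.
(* In the partial order of [R[i]] a positive radius has zero imaginary part, so it is a positive
   real. *)
move=> ua ub; apply/cvgrPdist_lt => -[e e']; rewrite ltcE/= => /andP[/eqP -> e0].
have e20 : 0 < e / 2 by rewrite divr_gt0.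
move/cvgrPdist_lt : ua => /(_ _ e20); move/cvgrPdist_lt : ub => /(_ _ e20).
apply: filterS2 => n ubn uan.
rewrite normCE -[ltRHS]/(e%:C%C) ltcR (le_lt_trans (cmod_le_ReIm _))//.
by case: (u n) uan ubn => x y /=; lra.
Qed.

End ComplexModulus.

(** * Infinite products of masks *)

Section InfiniteProduct.
Context {R : realType}.
Variable M : R -> R.
Hypotheses (M_ge0 : forall t, 0 <= M t) (M_le1 : forall t, M t <= 1).

(** The squared moduli get a real product of their own: its factors lie in [0, 1], so it converges
    by monotonicity, whereas the complex product needs regularity of [H] at 0. *)
Definition dyadic_prod k w := \prod_(1 <= l < k.+1) M (2 ^- l * w).

Definition dyadic_infprod w := limn (dyadic_prod ^~ w).

Lemma dyadic_prodS k w :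
  dyadic_prod k.+1 w = M (w / 2) * dyadic_prod k (w / 2).
Proof.
rewrite /dyadic_prod big_ltn// expr1 [2^-1 * w]mulrC; congr (_ * _).
rewrite big_add1/=; apply: eq_big_nat => l _; congr M.
by rewrite exprSr invfM -mulrA [2^-1 * w]mulrC.
Qed.

Lemma dyadic_prodSr k w :
  dyadic_prod k.+1 w = dyadic_prod k w * M (2 ^- k.+1 * w).
Proof. by rewrite /dyadic_prod big_nat_recr. Qed.

Lemma dyadic_prod_ge0 k w : 0 <= dyadic_prod k w.
Proof. by apply: prodr_ge0. Qed.

Lemma dyadic_prod_le1 k w : dyadic_prod k w <= 1.
Proof.
elim: k w => [|k IH] w; first by rewrite /dyadic_prod big_geq.
by rewrite dyadic_prodS mulr_ile1 ?dyadic_prod_ge0.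
Qed.

Lemma cvgn_dyadic_prod w : cvgn (dyadic_prod ^~ w).
Proof.
apply: nonincreasing_is_cvgn.
  apply/nonincreasing_seqP => k.
  by rewrite dyadic_prodSr ler_piMr// dyadic_prod_ge0.
by exists 0 => _ [k _ <-]; exact: dyadic_prod_ge0.
Qed.

Lemma dyadic_infprod_ge0 w : 0 <= dyadic_infprod w.
Proof.
apply: limr_ge; first exact: cvgn_dyadic_prod.
by apply: nearW => k; exact: dyadic_prod_ge0.
Qed.

Lemma dyadic_infprod_le1 w : dyadic_infprod w <= 1.
Proof.
apply: limr_le; first exact: cvgn_dyadic_prod.
by apply: nearW => k; exact: dyadic_prod_le1.
Qed.

Lemma dyadic_infprodE w :
  dyadic_infprod w = M (w / 2) * dyadic_infprod (w / 2).
Proof.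
apply/cvg_lim => //; rewrite -(cvg_shiftS (dyadic_prod ^~ w)).
under eq_fun do rewrite dyadic_prodS.
by apply: cvgMr; exact: cvgn_dyadic_prod.
Qed.

Lemma measurable_dyadic_infprod :
  continuous M -> measurable_fun setT dyadic_infprod.
Proof.
move=> cM; apply: (@measurable_fun_cvg _ _ _ _ dyadic_prod) => //.
  move=> k; elim: k => [|k IH].
    rewrite (_ : dyadic_prod 0 = cst 1)//.
    by apply/funext => w; rewrite /dyadic_prod big_geq.
  rewrite (_ : dyadic_prod _ = fun w => dyadic_prod k w * M (2 ^- k.+1 * w)).
    apply: measurable_funM => //; apply: measurableT_comp.
      exact: continuous_measurable_fun.
    exact: measurable_funM.
  by apply/funext => w; rewrite dyadic_prodSr.
by move=> w _; exact: cvgn_dyadic_prod.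
Qed.

End InfiniteProduct.

Section MaskProduct.
Context {R : realType}.
Implicit Types (t w : R).

Lemma lipschitz_trig_poly (L : nat) (h : nat -> R[i]) :
  let H t := \sum_(0 <= nu < L.+1) h nu * expi (- (nu%:R * t)) in
  exists2 C : R, 0 <= C & forall t, cmod (H t - H 0) <= C * `|t|.
Proof.
move=> H; exists (\sum_(0 <= nu < L.+1) cmod (h nu) * (2 * nu%:R)).
  by apply: sumr_ge0 => nu _; rewrite mulr_ge0 ?cmod_ge0.
move=> t; rewrite /H -sumrB mulr_suml (le_trans (cmod_sum_le _ _))//.
apply: ler_sum => nu _; rewrite mulr0 oppr0.
have -> : expi (0 : R) = 1 by rewrite /expi cos0 sin0.
rewrite -mulrBr cmodM -mulrA ler_wpM2l ?cmod_ge0//.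
rewrite (le_trans (cmod_expi_sub1 _))// normrN normrM [`|nu%:R|]ger0_norm//.
by rewrite mulrA.
Qed.

Variables (n : nat) (H : R -> R[i]).
Hypothesis maskH : is_daubechies_mask n.+1 H.

(** The moduli of the partial products are known at once. What has to be proved is that the complex
    partial products converge, so that the [lim] in [infprod] is a genuine limit: convergence of the
    moduli says nothing about the phases. *)
Lemma cmod_infprod_mask w :
  cmod (infprod (fun l => H (2 ^- l * w))) ^+ 2 = dyadic_infprod (dmask n) w.
Proof.
pose P k := \prod_(1 <= l < k.+1) H (2 ^- l * w).
have PM k : cmod (P k) ^+ 2 = dyadic_prod (dmask n) k w.
  rewrite /P cmod_prod -prodrXl; apply: eq_bigr => l _.
  exact: daubechies_mask_dmask.
have P1 k : cmod (P k) <= 1.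
  rewrite -(@ler_pXn2r _ 2)// ?nnegrE ?cmod_ge0// expr1n PM.
  by apply: dyadic_prod_le1 => t; rewrite ?dmask_ge0 ?dmask_le1.
have [[L [h hE]] _ H0] := maskH.
have [C C0 HC] := @lipschitz_trig_poly L h.
(* [H] is Lipschitz at 0 where it equals 1, and [|P k| <= 1], so the partial
   products have summable increments. *)
have incr k : cmod (P k.+1 - P k) <= (C * `|w|) / 2 ^+ k.
  rewrite /P big_nat_recr//= -/(P k) -{2}(mulr1 (P k)) -mulrBr cmodM.
  rewrite (le_trans (ler_wpM2r (cmod_ge0 _) (P1 _)))// mul1r -H0 !hE.
  rewrite (le_trans (HC _))// -mulrA ler_wpM2l// normrM mulrC ler_wpM2l//.
  rewrite ger0_norm// lef_pV2 ?posrE ?exprn_gt0//.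
  by rewrite exprS ler_peMl// ler1n.
have [cRe cIm] :
    cvgn (fun k => complex.Re (P k)) /\ cvgn (fun k => complex.Im (P k)).
  split; apply: (@cvgn_geometric_increments _ _ (C * `|w|)) => k;
    rewrite (le_trans _ (incr k))//.
  - by rewrite -raddfB norm_Re_le.
  - by rewrite -raddfB norm_Im_le.
have cP := cvgn_complex cRe cIm.
rewrite /infprod (cvg_lim _ cP); last exact: norm_hausdorff.
rewrite cmod_sqr/=; apply/esym/cvg_lim => //.
under eq_fun do rewrite -PM cmod_sqr !expr2.
by rewrite !expr2; apply: cvgD; apply: cvgM.
Qed.

Lemma cmod_fourier1_scaling phi w : is_scaling_function H phi ->
  cmod (fourier1 phi w) =
  (Num.sqrt (2 * pi))^-1 * Num.sqrt (dyadic_infprod (dmask n) w).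
Proof.
move=> [_ ->]; rewrite cmodM cmodC ger0_norm ?invr_ge0 ?sqrtr_ge0//.
by rewrite -cmod_infprod_mask sqrtr_sqr ger0_norm ?cmod_ge0.
Qed.

Lemma cmod_fourier1_wavelet psi w : is_wavelet H psi ->
  cmod (fourier1 psi w) = (Num.sqrt (2 * pi))^-1 *
    Num.sqrt (dmask n (w / 2 + pi) * dyadic_infprod (dmask n) (w / 2)).
Proof.
move=> [_ ->]; rewrite !cmodM cmodC ger0_norm ?invr_ge0 ?sqrtr_ge0// -mulrA.
rewrite -cmod_infprod_mask -(daubechies_mask_dmask _ maskH) -exprMn sqrtr_sqr.
rewrite ger0_norm ?mulr_ge0 ?cmod_ge0//; congr (_ * (_ * cmod (infprod _))).
by apply/funext => l; rewrite exprSr invfM -mulrA [2^-1 * w]mulrC.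
Qed.

End MaskProduct.

(** * Uniform decay and pointwise limits of the infinite products *)

Section ProductDecay.
Context {R : realType}.
Implicit Types (t w : R) (n N j k : nat).

Definition phi_sqr n w : R := dyadic_infprod (dmask n) w.

Lemma phi_sqr_ge0 n w : 0 <= phi_sqr n w.
Proof. by apply: dyadic_infprod_ge0 => t; rewrite ?dmask_ge0 ?dmask_le1. Qed.

Lemma phi_sqr_le1 n w : phi_sqr n w <= 1.
Proof. by apply: dyadic_infprod_le1 => t; rewrite ?dmask_ge0 ?dmask_le1. Qed.

Lemma phi_sqrE n w : phi_sqr n w = dmask n (w / 2) * phi_sqr n (w / 2).
Proof. by apply: dyadic_infprodE => t; rewrite ?dmask_ge0 ?dmask_le1. Qed.

Lemma phi_sqr_double n w : phi_sqr n (2 * w) = dmask n w * phi_sqr n w.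
Proof. by rewrite phi_sqrE [2 * w]mulrC mulfK. Qed.

Lemma phi_sqr_double_le n w : phi_sqr n (2 * w) <= phi_sqr n w.
Proof. by rewrite phi_sqr_double ler_piMl ?phi_sqr_ge0 ?dmask_le1. Qed.

(* The identity [sin (2 x) = 2 sin x cos x] telescopes the product of the
   upper bounds [dmask_le_cos]. *)
Lemma phi_sqr_dyadic_le N n j t : (N.*2 <= n)%N ->
  phi_sqr n (2 ^+ j * t) * ((1 - cos t) / 2) ^+ N <=
  ((3 / 4) ^+ j * ((1 - cos (2 ^+ j * t)) / 2)) ^+ N.
Proof.
move=> nN; have s0 u : 0 <= (1 - cos u) / 2 :> R by have := cos_le1 u; lra.
elim: j => [|j IH].
  by rewrite !expr0 !mul1r ler_piMl ?phi_sqr_le1 ?exprn_ge0.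
have := dmask_le_cos (2 ^+ j * t) nN.
have := cos_mulr2n (2 ^+ j * t).
have -> : (2 ^+ j * t) *+ 2 = 2 ^+ j.+1 * t by rewrite exprS -mulrA mulr_natl.
rewrite exprS -[2 * _ * t]mulrA phi_sqr_double; move: IH.
set u := 2 ^+ j * t => IH cosE Mle.
rewrite -mulrA; apply: le_trans (ler_pM (dmask_ge0 _ _) _ Mle IH) _.
  by rewrite mulr_ge0 ?phi_sqr_ge0 ?exprn_ge0.
rewrite -exprMn le_eqVlt; apply/orP; left; apply/eqP; congr (_ ^+ N).
by rewrite cosE exprS mulr2n; field.
Qed.

(** Beyond [pi], halving reaches a point [t] with [cos t < 0] after at least one step. There
    [(1 - cos t) / 2] exceeds [1 / 2], which makes the telescoped bound effective, and [M(t)] is a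
    factor of the product that tends to 0. *)
Lemma dyadic_scale w : pi < `|w| ->
  exists j t, [/\ w = 2 ^+ j.+1 * t, pi / 2 < `|t| & `|t| <= pi].
Proof.
move=> piw; have pi0 := @pi_gt0 R.
have ex : exists j, `|w| <= 2 ^+ j * pi.
  exists (Num.trunc (`|w| / pi)).+1; rewrite -ler_pdivrMr// ltW//.
  rewrite (lt_le_trans (truncnS_gt _))// -natrX ler_nat.
  exact: ltnW (ltn_expl _ _).
case: (ex_minnP ex) => -[|j]; first by rewrite expr0 mul1r leNgt piw.
move=> wj minj; exists j, (w / 2 ^+ j.+1).
have p2 : 0 < 2 ^+ j.+1 :> R by rewrite exprn_gt0.
rewrite normrM normfV (ger0_norm (ltW p2)); split.
- by rewrite mulrC divfK// gt_eqF.
- rewrite ltr_pdivlMr// ltNge; apply/negP => h.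
  suff /minj : `|w| <= 2 ^+ j * pi by rewrite ltnn.
  by rewrite (le_trans h)// exprS; lra.
- by rewrite ler_pdivrMr// mulrC.
Qed.

Lemma cos_lt0_pihalf t : pi / 2 < `|t| -> `|t| <= pi -> cos t < 0.
Proof.
move=> t1 t2; have pi0 := @pi_gt0 R.
rewrite -cos_norm -(subrK (pi / 2) `|t|) cosDpihalf oppr_lt0.
by apply: sin_gt0_pi; lra.
Qed.

(** The telescoped bound is applied with exponent [3 N], hence the threshold [6 N]: as
    [(3 / 4) ^ 3 <= 1 / 2], each doubling of the frequency gains [2 ^- N], exactly what [|w| ^ N]
    loses. The factor [8 ^ N] pays for [((1 - cos t) / 2) ^ (3 N) >= (1 / 2) ^ (3 N)], and [pi ^ N]
    comes from [|t| <= pi]. *)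
Lemma phi_sqr_decay N n w : (6 * N <= n)%N ->
  `|w| ^+ N * phi_sqr n w <= (8 * pi) ^+ N.
Proof.
move=> nN; have pi0 := @pi_gt0 R.
have [wpi|/dyadic_scale[j [t [wE t1 t2]]]] := lerP `|w| pi.
  rewrite (@le_trans _ _ (`|w| ^+ N))//.
    by rewrite ler_piMr ?exprn_ge0 ?phi_sqr_le1.
  by rewrite lerXn2r ?nnegrE ?mulr_ge0//; lra.
have ct := cos_lt0_pihalf t1 t2.
have nN3 : ((3 * N).*2 <= n)%N by rewrite -mul2n mulnA.
have := phi_sqr_dyadic_le j.+1 t nN3; rewrite -wE => le1.
have le2 : phi_sqr n w * ((1 / 2) ^+ (3 * N)) <= ((3 / 4) ^+ j.+1) ^+ (3 * N).
  apply: (@le_trans _ _ (phi_sqr n w * ((1 - cos t) / 2) ^+ (3 * N))).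
    by rewrite ler_wpM2l ?phi_sqr_ge0// lerXn2r ?nnegrE//; lra.
  have c1 := cos_le1 w; have cN1 := cos_geN1 w.
  have q0 : 0 <= (3 / 4 : R) ^+ j.+1 by rewrite exprn_ge0//; lra.
  apply: le_trans le1 _; apply: lerXn2r; rewrite ?nnegrE//.
  by rewrite ler_piMr//; lra.
have le3 : ((3 / 4 : R) ^+ j.+1) ^+ (3 * N) <= ((1 / 2) ^+ j.+1) ^+ N.
  rewrite exprM -[in X in X ^+ N]exprM mulnC exprM.
  apply: lerXn2r; rewrite ?nnegrE ?exprn_ge0//; try lra.
  apply: lerXn2r; rewrite ?nnegrE ?exprn_ge0//; lra.
have {le1 le2 le3} le4 := le_trans le2 le3.
have wle : `|w| <= 2 ^+ j.+1 * pi.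
  by rewrite wE normrM ger0_norm ?exprn_ge0// ler_wpM2l ?exprn_ge0.
have -> : phi_sqr n w = (phi_sqr n w * (1 / 2) ^+ (3 * N)) * 8 ^+ N.
  rewrite -mulrA exprM -exprMn (_ : (1 / 2) ^+ 3 * 8 = 1); last by field.
  by rewrite expr1n mulr1.
rewrite mulrA; apply: (@le_trans _ _
  (((2 ^+ j.+1 * pi) ^+ N * ((1 / 2) ^+ j.+1) ^+ N) * 8 ^+ N)).
  rewrite ler_wpM2r ?exprn_ge0// ler_pM// ?exprn_ge0//.
  - by rewrite mulr_ge0 ?phi_sqr_ge0 ?exprn_ge0//; lra.
  - by rewrite lerXn2r ?nnegrE ?mulr_ge0 ?exprn_ge0// ltW.
have E : 2 ^+ j.+1 * pi * (1 / 2) ^+ j.+1 = pi :> R.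
  by rewrite mulrAC -exprMn mulrCA divff ?mulr1 ?expr1n ?mul1r.
by rewrite -!exprMn E mulrC.
Qed.

Lemma cvg_dmask1 t : 0 < cos t -> dmask n t @[n --> \oo] --> (1 : R).
Proof.
move=> ct; have -> : dmask ^~ t = (fun n => 1 - dmask n (t + pi)).
  by apply/funext => n; rewrite dmaskDpi subKr.
rewrite -[X in _ --> X]subr0; apply: cvgB; first exact: cvg_cst.
by apply: cvg_dmask0; rewrite cosDpi oppr_lt0.
Qed.

Lemma cos_ge0_half w : `|w| <= pi -> 0 <= cos (w / 2).
Proof. by rewrite ler_norml => h; apply: cos_ge0_pihalf; lra. Qed.

(** The deficits [1 - M] at least halve from scale to scale, so their sum is at most twice the
    first. In the induction, with [a] and [b] the masks at [w / 2] and [w / 4], one has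
    [1 - 2 (1 - b) >= a], and [a ^ 2 >= 2 a - 1] closes the step. The bound does not depend on [k],
    so it survives the passage to the infinite product. *)
Lemma dyadic_prod_dmask_ge n k w : `|w| <= pi ->
  1 - 2 * (1 - dmask n (w / 2)) <= dyadic_prod (dmask n) k w.
Proof.
elim: k w => [|k IH] w wpi.
  rewrite /dyadic_prod big_geq// gerBl mulr_ge0// subr_ge0.
  exact: dmask_le1.
have wpi2 : `|w / 2| <= pi.
  by rewrite normrM (@ger0_norm _ 2^-1)//; have := normr_ge0 w; lra.
rewrite dyadic_prodS.
have := onem_dmask_half n (cos_ge0_half wpi) (cos_ge0_half wpi2).
have := IH _ wpi2; have := dmask_le1 n (w / 2); have := dmask_ge0 n (w / 2).
set a := dmask n (w / 2); set b := dmask n (w / 2 / 2).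
by set q := dyadic_prod _ _ _; nra.
Qed.

Lemma cvg_phi_sqr1 w : `|w| < pi -> phi_sqr n w @[n --> \oo] --> (1 : R).
Proof.
move=> wpi.
apply: (@squeeze_cvgr _ _ _ _ (fun n => 1 - 2 * (1 - dmask n (w / 2))) (cst 1)).
- apply: nearW => n; rewrite phi_sqr_le1 andbT.
  apply: limr_ge.
    by apply: cvgn_dyadic_prod => t; rewrite ?dmask_ge0 ?dmask_le1.
  by apply: nearW => k; apply: dyadic_prod_dmask_ge; exact: ltW.
- rewrite -[X in _ --> X]subr0 -{1}(mulr0 2) -(subrr 1).
  apply: cvgB; first exact: cvg_cst.
  apply: cvgMr; apply: cvgB; first exact: cvg_cst.
  apply: cvg_dmask1; apply: cos_gt0_pihalf.
  by move: wpi; rewrite ltr_norml; lra.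
- exact: cvg_cst.
Qed.

Lemma cvg_phi_sqr0 w : pi < `|w| -> phi_sqr n w @[n --> \oo] --> (0 : R).
Proof.
move=> /dyadic_scale[j [t [-> t1 t2]]].
apply: (@squeeze_cvgr _ _ _ _ (cst 0) (fun n => dmask n t)).
- apply: nearW => n; rewrite phi_sqr_ge0/=; elim: j => [|j IH].
    by rewrite expr1 phi_sqr_double ler_piMr ?phi_sqr_le1 ?dmask_ge0.
  by rewrite exprS -mulrA (le_trans (phi_sqr_double_le _ _)).
- exact: cvg_cst.
- by apply: cvg_dmask0; exact: cos_lt0_pihalf.
Qed.

End ProductDecay.

(** * Moduli of the two transforms: limits and integrable majorants *)

Section Profiles.
Context {R : realType}.
Implicit Types (t w : R) (n a k : nat).

(* Up to the factor [1 / sqrt (2 pi)], [phi_abs n] and [psi_abs n] are the moduli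
   of the Fourier transforms of the scaling function and of the wavelet of order
   [n.+1]. *)
Definition phi_abs n w : R := Num.sqrt (phi_sqr n w).

Definition psi_abs n w : R :=
  Num.sqrt (dmask n (w / 2 + pi) * phi_sqr n (w / 2)).

Lemma phi_abs_ge0 n w : 0 <= phi_abs n w. Proof. exact: sqrtr_ge0. Qed.

Lemma psi_abs_ge0 n w : 0 <= psi_abs n w. Proof. exact: sqrtr_ge0. Qed.

Lemma cvg_sqrt (u : R^nat) (l : R) :
  u n @[n --> \oo] --> l -> Num.sqrt (u n) @[n --> \oo] --> Num.sqrt l.
Proof. by move=> ul; apply: continuous_cvg => //; exact: sqrt_continuous. Qed.

Lemma cvg_phi_abs1 w : `|w| < pi -> phi_abs n w @[n --> \oo] --> (1 : R).
Proof. by move=> /cvg_phi_sqr1/cvg_sqrt; rewrite sqrtr1. Qed.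

Lemma cvg_phi_abs0 w : pi < `|w| -> phi_abs n w @[n --> \oo] --> (0 : R).
Proof. by move=> /cvg_phi_sqr0/cvg_sqrt; rewrite sqrtr0. Qed.

Lemma norm_half w : `|w / 2| = `|w| / 2.
Proof. by rewrite normrM [`|2^-1|]ger0_norm. Qed.

Lemma cvg_psi_abs0l w : `|w| < pi -> psi_abs n w @[n --> \oo] --> (0 : R).
Proof.
move=> wpi; rewrite -[X in _ --> X]sqrtr0; apply: cvg_sqrt.
rewrite -(mul0r 1); apply: cvgM; last first.
  by apply: cvg_phi_sqr1; rewrite norm_half; have := normr_ge0 w; lra.
apply: cvg_dmask0; rewrite cosDpi oppr_lt0.
by apply: cos_gt0_pihalf; move: wpi; rewrite ltr_norml; lra.
Qed.

Lemma cvg_psi_abs1 w : pi < `|w| < pi * 2 ->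
  psi_abs n w @[n --> \oo] --> (1 : R).
Proof.
move=> /andP[w1 w2]; rewrite -[X in _ --> X]sqrtr1; apply: cvg_sqrt.
rewrite -[X in _ --> X](mul1r 1); apply: cvgM; last first.
  by apply: cvg_phi_sqr1; rewrite norm_half; lra.
apply: cvg_dmask1; rewrite cosDpi oppr_gt0.
by apply: cos_lt0_pihalf; rewrite norm_half; lra.
Qed.

Lemma cvg_psi_abs0r w : pi * 2 < `|w| -> psi_abs n w @[n --> \oo] --> (0 : R).
Proof.
move=> w2; rewrite -[X in _ --> X]sqrtr0; apply: cvg_sqrt.
apply: (@squeeze_cvgr _ _ _ _ (cst 0) (fun n => phi_sqr n (w / 2))).
- apply: nearW => n; rewrite mulr_ge0 ?dmask_ge0 ?phi_sqr_ge0//=.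
  by rewrite ler_piMl ?phi_sqr_ge0 ?dmask_le1.
- exact: cvg_cst.
- by apply: cvg_phi_sqr0; rewrite norm_half; lra.
Qed.

(** Squaring turns the exponent [a] into [N = 2 a], which doubles the threshold from 6 to 12. *)
Lemma phi_abs_decay a n w : (12 * a <= n)%N ->
  `|w| ^+ a * phi_abs n w <= (8 * pi) ^+ a.
Proof.
move=> an; have pi0 := @pi_gt0 R.
rewrite -(@ler_pXn2r _ 2)// ?nnegrE ?mulr_ge0 ?exprn_ge0 ?phi_abs_ge0//; last first.
  by rewrite mulr_ge0// ltW.
rewrite exprMn sqr_sqrtr ?phi_sqr_ge0// -!exprM; apply: phi_sqr_decay.
by rewrite mulnCA mulnC -mulnA mulnC (leq_trans _ an)// mulnC mulnA.
Qed.

(** Adding the decay bounds for the exponents [a] and [a.+2] produces the factor [1 + w ^ 2]. *)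
Lemma phi_abs_dominated a : exists2 C, 0 <= C &
  forall n w, (12 * a.+2 <= n)%N -> `|w| ^+ a * phi_abs n w <= C / (1 + w ^+ 2).
Proof.
have pi0 := @pi_gt0 R; have p8 : 0 <= 8 * pi :> R by rewrite mulr_ge0// ltW.
exists ((8 * pi) ^+ a + (8 * pi) ^+ a.+2); first by rewrite addr_ge0 ?exprn_ge0.
move=> n w an; rewrite ler_pdivlMr; last by rewrite ltr_pwDl ?sqr_ge0.
rewrite mulrDr mulr1 lerD ?phi_abs_decay//.
  by rewrite (leq_trans _ an)// leq_mul2l/= ltnW.
have := phi_abs_decay w an; rewrite -addn2 exprD -{1}(real_normK (num_real w)).
by rewrite mulrAC.
Qed.

Lemma psi_abs_le1 n w : psi_abs n w <= 1.
Proof.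
rewrite -sqrtr1 ler_wsqrtr// mulr_ile1 ?dmask_ge0 ?phi_sqr_ge0//.
  exact: dmask_le1.
exact: phi_sqr_le1.
Qed.

(** A quantitative form of the vanishing moments: the high-pass factor [M(w / 2 + pi)] is at most
    [(3 / 2 (1 - cos (w / 2))) ^ k], and [1 - cos (w / 2) <= w ^ 2 / 8]. *)
Lemma psi_abs_le n k w : (k.*2 <= n)%N -> psi_abs n w <= `|w| ^+ k.
Proof.
move=> kn; rewrite -[leRHS]ger0_norm ?exprn_ge0// -sqrtr_sqr ler_wsqrtr//.
apply: le_trans (ler_piMr (dmask_ge0 _ _) (phi_sqr_le1 _ _)) _.
apply: le_trans (dmask_le_cos _ kn) _.
rewrite exprAC real_normK ?num_real// cosDpi.
have c1 := cos_le1 (w / 2); have c2 := onem_cos_le (w / 2).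
by apply: lerXn2r; rewrite ?nnegrE ?sqr_ge0//; lra.
Qed.

Lemma psi_abs_dominated k : exists2 C, 0 <= C &
  forall n w, (24 + k.*2 <= n)%N -> `|w| ^- k * psi_abs n w <= C / (1 + w ^+ 2).
Proof.
have [C C0 HC] := phi_abs_dominated 0.
(* On [|w| <= 1] flatness at the origin absorbs the weight and [1 + w ^ 2 <= 2]. For [|w| > 1] the
   weight is at most 1 and the decay at [w / 2] applies, with [1 + w ^ 2 <= 4 (1 + (w / 2) ^ 2)].
   The threshold adds those of the two bounds, 24 being [12 * 2]. *)
exists (2 + 4 * C) => [|n w kn]; first by rewrite addr_ge0// mulr_ge0.
have w1 : 0 < 1 + w ^+ 2 by rewrite ltr_pwDl ?sqr_ge0.
rewrite ler_pdivlMr//; have [wle|wge] := lerP `|w| 1.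
  have le1 : `|w| ^- k * psi_abs n w <= 1.
    have [->|w0] := eqVneq `|w| 0.
      (* At the origin the weight is 1 for [k = 0], and 0 for positive [k] because the inverse of 0
         is 0. *)
      case: k kn => [|k] kn; first by rewrite expr0 invr1 mul1r psi_abs_le1.
      by rewrite expr0n/= invr0 mul0r.
    rewrite mulrC ler_pdivrMr ?exprn_gt0 ?lt_def ?w0//= mul1r.
    by apply: psi_abs_le; rewrite (leq_trans _ kn)// leq_addl.
  have w2 : w ^+ 2 <= 1 by rewrite -real_normK ?num_real// exprn_ile1.
  have p0 : 0 <= `|w| ^- k * psi_abs n w.
    by rewrite mulr_ge0 ?psi_abs_ge0// invr_ge0 exprn_ge0.
  nra.
have pk : `|w| ^- k <= 1 by rewrite invf_le1 ?exprn_gt0 ?exprn_ege1// ?ltW//; lra.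
have /(HC n (w / 2)) : (12 * 0.+2 <= n)%N by rewrite (leq_trans _ kn)// leq_addr.
rewrite expr0 mul1r ler_pdivlMr; last by rewrite ltr_pwDl ?sqr_ge0.
have pp : psi_abs n w <= phi_abs n (w / 2).
  by rewrite ler_wsqrtr// ler_piMl ?phi_sqr_ge0 ?dmask_le1.
have := psi_abs_ge0 n w; have : 0 <= `|w| ^- k by rewrite invr_ge0 exprn_ge0.
have := sqr_ge0 w; rewrite exprMn.
set x := `|w| ^- k in pk *; set y := psi_abs n w in pp *.
set z := phi_abs _ _ in pp *.
set v := w ^+ 2 => v0 x0 y0 zC.
have xy : x * y <= y by rewrite ler_piMl.
have : x * y * (1 + v) <= y * (1 + v) by rewrite ler_wpM2r//; lra.
have : y * (1 + v * 2^-1 ^+ 2) <= z * (1 + v * 2^-1 ^+ 2).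
  by rewrite ler_wpM2r//; lra.
by nra.
Qed.

End Profiles.

(** * Dominated convergence *)

Section Domination.
Context {R : realType}.
Local Notation mu := (@lebesgue_measure R).

Lemma cvg_powR (u : R^nat) (l p : R) : 1 <= p -> (forall n, 0 <= u n) ->
  u n @[n --> \oo] --> l -> u n `^ p @[n --> \oo] --> l `^ p.
Proof.
move=> p1 u0 ul; have p0 : 0 < p by rewrite (lt_le_trans ltr01).
have l0 : 0 <= l.
  rewrite -(cvg_lim _ ul)//.
  by apply: limr_ge; [apply/cvg_ex; exists l|exact: nearW].
move: l0; rewrite le_eqVlt => /predU1P[l0|l0].
  rewrite -l0 powR0 ?gt_eqF//; rewrite -l0 in ul.
  apply: (@squeeze_cvgr _ _ _ _ (cst 0) u) => //; last exact: cvg_cst.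
  have : \forall n \near \oo, u n <= 1.
    by move/cvgr_le : ul; apply; exact: ltr01.
  apply: filterS => n un; rewrite powR_ge0/=.
  move: (u0 n); rewrite le_eqVlt => /predU1P[<-|un0].
    by rewrite powR0 ?gt_eqF.
  by rewrite ge1r_powR// un0 un.
have cp : (fun x : R => x `^ p) x @[x --> l] --> l `^ p.
  apply: (@differentiable_continuous _ _ _ l (fun x : R => x `^ p)).
  apply/derivable1_diffP.
  by apply: derivable_powR; rewrite in_itv/= l0.
exact: (cvg_comp u _ ul cp).
Qed.

Lemma integrable_oneDsqrV : mu.-integrable setT (fun w => ((1 + w ^+ 2)^-1)%:E).
Proof.
have cf := @continuous_oneDsqrV R.
apply/integrableP; split.
  by apply/measurable_EFinP; apply: continuous_measurable_fun.
under eq_integral => w _.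
  rewrite gee0_abs; last by rewrite lee_fin invr_ge0 addr_ge0 ?sqr_ge0.
  over.
rewrite (@ge0_symfun_integralT R (fun w => (oneDsqr w)^-1))//.
- by rewrite -set_itvcy integral0y_oneDsqr -EFinM ltry.
- by move=> w; rewrite /= /oneDsqr sqrrN.
Qed.

(** Since [(1 + w ^ 2)^-1 <= 1] and [p >= 1], the [p]-th power of the majorant is at most
    [C ^ p / (1 + w ^ 2)], which is integrable for every such [p]. The index shift by [n0] discards
    the orders for which the bound may fail. *)
Lemma cvg_Lp_dominated (f_ : nat -> R -> R) (f : R -> R) (S : set R) (p C : R)
    (n0 : nat) : 1 <= p -> 0 <= C -> countable S ->
  (forall n, measurable_fun setT (f_ n)) -> measurable_fun setT f ->
  (forall n w, 0 <= f_ n w) ->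
  (forall n w, (n0 <= n)%N -> f_ n w <= C / (1 + w ^+ 2)) ->
  (forall w, ~ S w -> f_ n w @[n --> \oo] --> f w) ->
  (\int[mu]_w (f_ n w `^ p)%:E)%E @[n --> \oo] --> (\int[mu]_w (f w `^ p)%:E)%E.
Proof.
move=> p1 C0 cS mf_ mf f_0 f_C f_f.
have p0 : 0 <= p by rewrite (le_trans ler01).
rewrite -(cvg_shiftn n0).
have [|||||_ _ //] := @dominated_convergence _ _ R mu setT measurableT
  (fun n w => (f_ (n + n0)%N w `^ p)%:E) (fun w => (f w `^ p)%:E)
  (fun w => ((C `^ p)%:E * ((1 + w ^+ 2)^-1)%:E)%E).
- move=> n; apply/measurable_EFinP.
  exact: (measurableT_comp (measurable_powR p) (mf_ (n + n0)%N)).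
- by apply/measurable_EFinP; exact: (measurableT_comp (measurable_powR p) mf).
- exists S; split.
  + exact: countable_measurable.
  + exact: countable_lebesgue_measure0.
  + move=> w /= Hw; apply: contrapT => Sw; apply: Hw => _.
    apply: cvg_EFin; first exact: nearW.
    apply: cvg_powR => //.
    by rewrite (cvg_shiftn n0 (fun n => f_ n w)); exact: f_f.
- by apply: integrableZl => //; exact: integrable_oneDsqrV.
- apply: aeW => w n _.
  rewrite gee0_abs ?lee_fin ?powR_ge0//=.
  have w1 : 1 <= 1 + w ^+ 2 by rewrite lerDl sqr_ge0.
  have w0 : 0 < 1 + w ^+ 2 by rewrite (lt_le_trans ltr01).
  apply: (@le_trans _ _ ((C / (1 + w ^+ 2)) `^ p)).
    by rewrite ge0_ler_powR ?nnegrE ?divr_ge0 ?f_C ?leq_addl// ltW.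
  rewrite powRM ?invr_ge0 ?(ltW w0)// ler_wpM2l ?powR_ge0//.
  by rewrite ge1r_powR// invr_gt0 w0 invf_le1.
Qed.

End Domination.

(** * Integrals of powers over intervals and symmetric annuli *)

Section PowerIntegrals.
Context {R : realType}.
Local Notation mu := (@lebesgue_measure R).

(** The disjunction excludes exactly the singular case of a negative power at 0. *)
Lemma cvg_at_right_powR (a s : R) : 0 <= a -> 0 < a \/ 0 <= s ->
  x `^ s @[x --> a^'+] --> a `^ s.
Proof.
rewrite le_eqVlt => /predU1P[<-|a0] as0.
  have {as0} s0 : 0 <= s by case: as0 => //; rewrite ltxx.
  move: s0; rewrite le_eqVlt => /predU1P[<-|s0].
    under eq_fun do rewrite powRr0.
    by rewrite powRr0; exact: cvg_cst.
  by rewrite powR0 ?gt_eqF//; exact: powR_cvg0.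
apply: cvg_at_right_filter.
apply: (@differentiable_continuous _ _ _ a (fun x : R => x `^ s)).
apply/derivable1_diffP.
by apply: derivable_powR; rewrite in_itv/= a0.
Qed.

Lemma continuous_powR_gt0 (s x : R) : 0 < x ->
  {for x, continuous (fun x : R => x `^ s)}.
Proof.
move=> x0.
apply: (@differentiable_continuous _ _ _ x (fun x : R => x `^ s)).
by apply/derivable1_diffP; apply: derivable_powR; rewrite in_itv/= x0.
Qed.

Lemma within_continuous_powR (a b s : R) : 0 <= a -> a < b -> 0 < a \/ 0 <= s ->
  {within `[a, b], continuous (fun x : R => x `^ s)}.
Proof.
move=> a0 ab as0; apply/(continuous_within_itvP _ ab); split.
- by move=> x; rewrite in_itv/= => /andP[ax _]; apply: continuous_powR_gt0; lra.
- exact: cvg_at_right_powR.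
- by apply: cvg_at_left_filter; apply: continuous_powR_gt0; lra.
Qed.

Lemma integral_powR (a b s : R) : 0 <= a -> a < b -> 0 < a \/ 0 <= s ->
  s + 1 != 0 ->
  (\int[mu]_(x in `[a, b]) (x `^ s)%:E =
   ((b `^ (s + 1) - a `^ (s + 1)) / (s + 1))%:E)%E.
Proof.
move=> a0 ab as0 s1.
rewrite (@continuous_FTC2 _ _ (fun x => (s + 1)^-1 * x `^ (s + 1)))//.
- by rewrite -EFinB -mulrBr mulrC.
- exact: within_continuous_powR.
- split.
  + move=> x; rewrite in_itv/= => /andP[ax _].
    apply: derivableM => //; apply: derivable_powR.
    by rewrite in_itv/= (le_lt_trans a0).
  + apply: cvgMr; apply: cvg_at_right_powR => //.
    by case: as0 => [|s0]; [left|right; rewrite addr_ge0].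
  + by apply: cvgMr; apply: cvg_at_left_filter; apply: continuous_powR_gt0; lra.
- move=> x; rewrite in_itv/= => /andP[ax _].
  have x0 : 0 < x by rewrite (le_lt_trans a0).
  rewrite derive1E deriveM//; last by apply: derivable_powR; rewrite in_itv/= x0.
  rewrite derive_cst scaler0 addr0 -derive1E powR_derive1 ?in_itv/= ?x0//.
  by rewrite addrK /GRing.scale/= mulKf.
Qed.

(** Up to finitely many points both limit profiles are indicators of such sets, with radii 0 and
    [pi] for the scaling function, [pi] and [2 pi] for the wavelet. *)
Definition annulus (a b : R) : set R := [set x | a < `|x| <= b].

Lemma annulusE (a b : R) : 0 <= a ->
  annulus a b = `]a, b]%classic `|` `[- b, - a[%classic.
Proof.
move=> a0; apply/seteqP; split => x; rewrite /annulus/= !in_itv/=.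
  by have [x0|x0] := ger0P x => /andP[ax xb]; [left|right]; apply/andP; split; lra.
have [x0|x0] := ger0P x => -[|] /andP[ax xb]; apply/andP; split; lra.
Qed.

Lemma measurable_annulus (a b : R) : 0 <= a -> measurable (annulus a b).
Proof. by move=> a0; rewrite annulusE//; apply: measurableU. Qed.

Lemma measurable_norm_powR (s : R) (D : set R) :
  measurable_fun D (fun x => (`|x| `^ s)%:E).
Proof.
apply: (@measurable_funS _ _ _ _ setT) => //; apply/measurable_EFinP.
apply: (measurableT_comp (measurable_powR s)).
exact: continuous_measurable_fun (@norm_continuous _ R^o).
Qed.

Lemma integral_annulus (a b s : R) : 0 <= a -> a < b -> 0 < a \/ 0 <= s ->
  s + 1 != 0 ->
  (\int[mu]_(x in annulus a b) (`|x| `^ s)%:E =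
   (2 * ((b `^ (s + 1) - a `^ (s + 1)) / (s + 1)))%:E)%E.
Proof.
move=> a0 ab as0 s1; rewrite annulusE// ge0_integral_setU//; first last.
- apply/disj_setPS => x /= []; rewrite !in_itv/= => /andP[ax _] /andP[_ xa].
  by suff : false; lra.
- exact: measurable_norm_powR.
rewrite integral_itv_obnd_cbnd; last exact: measurable_norm_powR.
rewrite integral_itv_bndo_bndc; last exact: measurable_norm_powR.
have pos : (\int[mu]_(x in `[a, b]) (`|x| `^ s)%:E =
    ((b `^ (s + 1) - a `^ (s + 1)) / (s + 1))%:E)%E.
  rewrite -(integral_powR a0 ab as0 s1); apply: eq_integral => x.
  by rewrite inE/= in_itv/= => /andP[ax _]; rewrite ger0_norm// (le_trans a0).
have cN : {within `[- b, - a], continuous (fun x : R => (- x) `^ s)}.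
  apply/(continuous_within_itvP _ _); first by rewrite ltrN2.
  split.
  - move=> x; rewrite in_itv/= => /andP[_ xa].
    apply: (@continuous_comp _ _ _ -%R (fun x : R => x `^ s)).
      exact: opp_continuous.
    by apply: continuous_powR_gt0; lra.
  - apply: cvg_at_right_filter.
    apply: (@continuous_comp _ _ _ -%R (fun x : R => x `^ s)).
      exact: opp_continuous.
    by apply: continuous_powR_gt0; lra.
  - apply/cvg_at_leftNP; rewrite /= !opprK.
    have -> : (fun x : R => (- x) `^ s) \o -%R = (fun x => x `^ s).
      by apply/funext => x /=; rewrite opprK.
    exact: cvg_at_right_powR.
have -> : (\int[mu]_(x in `[(- b)%R, (- a)%R]) (`|x| `^ s)%:E =
    \int[mu]_(x in `[(- b)%R, (- a)%R]) ((- x) `^ s)%:E)%E.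
  apply: eq_integral => x.
  by rewrite inE/= in_itv/= => /andP[_ xa]; rewrite ler0_norm//; lra.
rewrite (integration_by_substitution_oppr (ltW ab) cN)/=.
under [X in (_ + X)%E]eq_integral do rewrite /= opprK.
by rewrite pos integral_powR// -EFinD mulr_natl mulr2n.
Qed.

End PowerIntegrals.

(** * Convergence of the one-dimensional weighted integrals *)

Section WeightedIntegrals.
Context {R : realType}.
Local Notation mu := (@lebesgue_measure R).
Implicit Types (z : int) (p : R).

(** The one-dimensional factor of the [p]-th power of the norms in [Ckp]: [z] is minus a component
    of [k] in the numerator and 0 in the denominator. *)
Definition weighted_int z p (g : R -> R) : \bar R :=
  (\int[mu]_w ((`|w| ^ z * g w) `^ p)%:E)%E.

Lemma measurable_norm_exprz z : measurable_fun setT (fun w : R => `|w| ^ z).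
Proof.
rewrite (_ : (fun w : R => `|w| ^ z) = (fun w : R => `|w| `^ z%:~R)).
  by apply/measurable_EFinP; exact: measurable_norm_powR.
by apply/funext => w; rewrite powR_intmul.
Qed.

Lemma weighted_int_annulus z p a b : 1 <= p -> 0 <= a -> a < b ->
  0 < a \/ 0 <= z -> z%:~R * p + 1 != 0 ->
  weighted_int z p (\1_(annulus a b)) =
  (2 * ((b `^ (z%:~R * p + 1) - a `^ (z%:~R * p + 1)) / (z%:~R * p + 1)))%:E.
Proof.
move=> p1 a0 ab az zp; have p0 : 0 < p by rewrite (lt_le_trans ltr01).
have as0 : 0 < a \/ 0 <= z%:~R * p.
  by case: az => [|z0]; [left|right; rewrite mulr_ge0 ?ler0z// ltW].
rewrite -(integral_annulus a0 ab as0 zp).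
rewrite [RHS]integral_mkcond; apply: eq_integral => w _.
rewrite patchE indicE; case: ifPn => _ /=.
  by rewrite mulr1 -powR_intmul// powRrM.
by rewrite mulr0 powR0// gt_eqF.
Qed.

Lemma weighted_intZl z p (c : R) (g : R -> R) : 0 <= c -> (forall w, 0 <= g w) ->
  measurable_fun setT g ->
  weighted_int z p (fun w => c * g w) = ((c `^ p)%:E * weighted_int z p g)%E.
Proof.
move=> c0 g0 mg; rewrite /weighted_int -ge0_integralZl//; first last.
- by rewrite lee_fin powR_ge0.
- by move=> w _; rewrite lee_fin powR_ge0.
- apply/measurable_EFinP.
  apply: (measurableT_comp (measurable_powR p)).
  by apply: measurable_funM => //; exact: measurable_norm_exprz.
apply: eq_integral => w _; rewrite -EFinM mulrCA powRM//.
by rewrite mulr_ge0// exprz_ge0.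
Qed.

Lemma measurable_sqrt : measurable_fun setT (@Num.sqrt R).
Proof. exact: continuous_measurable_fun (@sqrt_continuous R). Qed.

Lemma measurable_phi_sqr n : measurable_fun setT (@phi_sqr R n).
Proof.
apply: measurable_dyadic_infprod => [t|t|]; last exact: continuous_dmask.
  exact: dmask_ge0.
exact: dmask_le1.
Qed.

Lemma measurable_phi_abs n : measurable_fun setT (@phi_abs R n).
Proof.
exact: (measurableT_comp measurable_sqrt (measurable_phi_sqr n)).
Qed.

Lemma measurable_psi_abs n : measurable_fun setT (@psi_abs R n).
Proof.
apply: (measurableT_comp measurable_sqrt).
apply: measurable_funM.
  apply: (measurableT_comp (continuous_measurable_fun (@continuous_dmask R n))).
  by apply: measurable_funD => //; exact: measurable_funM.
by apply: (measurableT_comp (measurable_phi_sqr n)); exact: measurable_funM.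
Qed.

Lemma measurable_weighted z (g : R -> R) : measurable_fun setT g ->
  measurable_fun setT (fun w : R => `|w| ^ z * g w).
Proof. by move=> mg; apply: measurable_funM => //; exact: measurable_norm_exprz. Qed.

Lemma cvg_weighted_int_phi z p : 1 <= p -> 0 <= z ->
  weighted_int z p (phi_abs n) @[n --> \oo] -->
  (2 * (pi `^ (z%:~R * p + 1) / (z%:~R * p + 1)))%:E.
Proof.
move=> p1 z0; have p0 : 0 < p by rewrite (lt_le_trans ltr01).
have zp : 0 < z%:~R * p + 1 by rewrite ltr_wpDl// mulr_ge0 ?ler0z// ltW.
have := @weighted_int_annulus z p 0 pi p1 (lexx _) (pi_gt0 R) (or_intror z0).
rewrite powR0 ?gt_eqF// subr0 => /(_ isT) <-.
case: z z0 zp => // a _ _.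
have [C C0 HC] := @phi_abs_dominated R a.
(* The exceptional points are the circle [|w| = pi], where no limit has been established, and the
   origin, which the annulus omits. *)
apply: (@cvg_Lp_dominated R (fun n w => `|w| ^+ a * phi_abs n w) _
  [set w | w \in [:: 0; pi; - pi]] p C (12 * a.+2)) => //.
- by apply: finite_set_countable; exact: finite_seq.
- by move=> n; exact: (measurable_weighted a (measurable_phi_abs n)).
- apply: (measurable_weighted a); apply: measurable_indic.
  exact: measurable_annulus.
- by move=> n w; rewrite mulr_ge0 ?exprn_ge0 ?phi_abs_ge0.
- move=> w /= /negP; rewrite !inE !negb_or => /and3P[w0 w1 w2].
  apply: cvgMr; rewrite indicE.
  have wpi : `|w| != pi by rewrite eqr_norml (negbTE w1) (negbTE w2).
  have [wlt|wge] := ltP `|w| pi.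
    by rewrite mem_set; [exact: cvg_phi_abs1|rewrite /annulus/= normr_gt0 w0 ltW].
  rewrite memNset; first by apply: cvg_phi_abs0; rewrite lt_def wpi.
  by rewrite /annulus/= => /andP[_ ?]; move/eqP: wpi; apply; lra.
Qed.

Lemma cvg_weighted_int_psi z p : 1 <= p -> z <= 0 -> z%:~R * p + 1 != 0 ->
  weighted_int z p (psi_abs n) @[n --> \oo] -->
  (2 * (((pi * 2) `^ (z%:~R * p + 1) - pi `^ (z%:~R * p + 1)) /
        (z%:~R * p + 1)))%:E.
Proof.
move=> p1 z0 zp; have pi0 := pi_gt0 R.
have pi2 : pi < pi * 2 :> R by lra.
have := @weighted_int_annulus z p pi (pi * 2) p1 (ltW pi0) pi2 (or_introl pi0) zp.
move=> <-.
have [k zk] : exists k : nat, z = - k%:Z.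
  by exists `|z|%N; rewrite lez0_abs// opprK.
rewrite {}zk in z0 zp *.
have wE (w : R) : `|w| ^ (- k%:Z) = `|w| ^- k by rewrite -exprnN.
have [C C0 HC] := @psi_abs_dominated R k.
apply: (@cvg_Lp_dominated R (fun n w => `|w| ^ (- k%:Z) * psi_abs n w) _
  [set w | w \in [:: pi; - pi; pi * 2; - (pi * 2)]] p C (24 + k.*2)) => //.
- by apply: finite_set_countable; exact: finite_seq.
- by move=> n; exact: (measurable_weighted _ (measurable_psi_abs n)).
- apply: measurable_weighted; apply: measurable_indic.
  by apply: measurable_annulus; exact: ltW.
- by move=> n w; rewrite mulr_ge0 ?exprz_ge0 ?psi_abs_ge0.
- by move=> n w; rewrite wE; exact: HC.
- move=> w /= /negP; rewrite !inE !negb_or => /and4P[w1 w2 w3 w4].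
  apply: cvgMr; rewrite indicE.
  have wpi : `|w| != pi by rewrite eqr_norml (negbTE w1) (negbTE w2).
  have wpi2 : `|w| != pi * 2 by rewrite eqr_norml (negbTE w3) (negbTE w4).
  have [wlt|wge] := ltP `|w| pi.
    rewrite memNset; first exact: cvg_psi_abs0l.
    by rewrite /annulus/= => /andP[]; lra.
  have {}wge : pi < `|w| by rewrite lt_def wpi.
  have [wlt2|wge2] := ltP `|w| (pi * 2).
    rewrite mem_set; first by apply: cvg_psi_abs1; rewrite wge.
    by rewrite /annulus/= wge ltW.
  have {}wge2 : pi * 2 < `|w| by rewrite lt_def wpi2.
  rewrite memNset; first exact: cvg_psi_abs0r.
  by rewrite /annulus/= => /andP[]; lra.
Qed.

End WeightedIntegrals.

(** * Tensor products *)

Section RealTensor.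
Context {R : realType}.
Local Notation mu := (@lebesgue1 R).
Implicit Types a b : R -> R.

Lemma measurable_fst_comp a : measurable_fun setT a ->
  measurable_fun setT (fun x : measurableTypeR R * measurableTypeR R => a x.1).
Proof. by move=> ma; exact: (measurableT_comp ma measurable_fst). Qed.

Lemma measurable_snd_comp a : measurable_fun setT a ->
  measurable_fun setT (fun x : measurableTypeR R * measurableTypeR R => a x.2).
Proof. by move=> ma; exact: (measurableT_comp ma measurable_snd). Qed.

Lemma ge0_integral_tensor a b : measurable_fun setT a -> measurable_fun setT b ->
  (forall x, 0 <= a x) -> (forall x, 0 <= b x) ->
  (\int[lebesgue2]_x (a x.1 * b x.2)%:E =
   (\int[mu]_x (a x)%:E) * (\int[mu]_x (b x)%:E))%E.
Proof.
move=> ma mb a0 b0; rewrite fubini_tonelli1/=; first last.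
- by move=> x; rewrite lee_fin mulr_ge0.
- apply/measurable_EFinP; apply: measurable_funM.
    exact: measurable_fst_comp.
  exact: measurable_snd_comp.
rewrite /fubini_F/=.
transitivity (\int[mu]_x ((a x)%:E * \int[mu]_y (b y)%:E))%E.
  apply: eq_integral => x _; rewrite -ge0_integralZl//.
  - by apply/measurable_EFinP.
  - by move=> y _; rewrite lee_fin.
  - by rewrite lee_fin.
rewrite ge0_integralZr//.
- by apply/measurable_EFinP.
- by move=> x _; rewrite lee_fin.
- by apply: integral_ge0 => y _; rewrite lee_fin.
Qed.

Lemma integrable_tensor a b :
  mu.-integrable setT (EFin \o a) -> mu.-integrable setT (EFin \o b) ->
  (@lebesgue2 R).-integrable setT (EFin \o (fun x => a x.1 * b x.2)).
Proof.
move=> ia ib.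
have ma : measurable_fun setT a.
  by apply/measurable_EFinP; exact: measurable_int ia.
have mb : measurable_fun setT b.
  by apply/measurable_EFinP; exact: measurable_int ib.
apply/integrableP; split.
  apply/measurable_EFinP; apply: measurable_funM.
    exact: measurable_fst_comp.
  exact: measurable_snd_comp.
under eq_integral do rewrite abse_EFin normrM.
rewrite (@ge0_integral_tensor (Num.norm \o a) (Num.norm \o b))//.
- have /integrableP[_ fa] := ia; have /integrableP[_ fb] := ib.
  apply: lte_mul_pinfty => //.
    by apply: integral_ge0 => x _; rewrite lee_fin/=.
  by rewrite ge0_fin_numE//; apply: integral_ge0 => x _; rewrite lee_fin/=.
- exact: measurableT_comp.
- exact: measurableT_comp.
- by move=> x /=.
- by move=> x /=.
Qed.

Lemma Rintegral_tensor a b :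
  mu.-integrable setT (EFin \o a) -> mu.-integrable setT (EFin \o b) ->
  \int[lebesgue2]_x (a x.1 * b x.2) = (\int[mu]_x a x) * (\int[mu]_x b x).
Proof.
move=> ia ib; have iab := integrable_tensor ia ib.
rewrite [LHS]/Rintegral -(integral12_prod_meas1 iab) /fubini_F/=.
transitivity (\int[mu]_x (a x * \int[mu]_y b y)).
  congr fine; apply: eq_integral => x _.
  rewrite EFinM fineK; last exact: integrable_fin_num.
  by rewrite -integralZl.
by rewrite RintegralZr.
Qed.

End RealTensor.

Section ComplexTensor.
Context {R : realType}.
Implicit Types f g : R -> R[i].

Lemma expiD (s t : R) : expi (s + t) = expi s * expi t.
Proof. by rewrite /expi cosD sinD; simpc; congr (_ +i* _)%C; rewrite addrC. Qed.

Lemma cintegrable_expi f w : cintegrable lebesgue1 f ->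
  cintegrable lebesgue1 (fun x => f x * expi (- (x * w))).
Proof.
move=> [fr fi].
have mc : measurable_fun setT (fun x : R => cos (- (x * w))).
  apply: (measurableT_comp (continuous_measurable_fun (@continuous_cos R))).
  by apply: measurable_funN; exact: measurable_funM.
have ms : measurable_fun setT (fun x : R => sin (- (x * w))).
  apply: (measurableT_comp (continuous_measurable_fun (@continuous_sin R))).
  by apply: measurable_funN; exact: measurable_funM.
have bc : [bounded cos (- (x * w)) | x in [set: R]].
  exists 1; split => // M M1 x _ /=; rewrite (le_trans (cos_max _))// ltW//.
have bs : [bounded sin (- (x * w)) | x in [set: R]].
  exists 1; split => // M M1 x _ /=; rewrite (le_trans (sin_max _))// ltW//.
split.
- rewrite (_ : (fun x => _) =
    (fun x => (complex.Re (f x))%:E * (cos (- (x * w)))%:E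
    - (complex.Im (f x))%:E * (sin (- (x * w)))%:E)%E).
    by apply: integrableB => //; apply: integrableMl.
  by apply/funext => x; rewrite /expi; case: (f x).
- rewrite (_ : (fun x => _) =
    (fun x => (complex.Re (f x))%:E * (sin (- (x * w)))%:E
    + (complex.Im (f x))%:E * (cos (- (x * w)))%:E)%E).
    by apply: integrableD => //; apply: integrableMl.
  by apply/funext => x; rewrite /expi; case: (f x).
Qed.

Lemma cintegral_tensor f g : cintegrable lebesgue1 f -> cintegrable lebesgue1 g ->
  cintegral lebesgue2 (fun x => f x.1 * g x.2) =
  cintegral lebesgue1 f * cintegral lebesgue1 g.
Proof.
move=> [fr fi] [gr gi]; rewrite /cintegral; simpc.
rewrite -!Rintegral_tensor//; congr (_ +i* _)%C.
- rewrite -RintegralB//; last 2 first.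
  + exact: (@integrable_tensor _ (@complex.Re R \o f) (@complex.Re R \o g) fr gr).
  + exact: (@integrable_tensor _ (@complex.Im R \o f) (@complex.Im R \o g) fi gi).
  by apply: eq_Rintegral => x _ /=; case: (f x.1); case: (g x.2).
- rewrite -RintegralD//; last 2 first.
  + exact: (@integrable_tensor _ (@complex.Re R \o f) (@complex.Im R \o g) fr gi).
  + exact: (@integrable_tensor _ (@complex.Im R \o f) (@complex.Re R \o g) fi gr).
  by apply: eq_Rintegral => x _ /=; case: (f x.1); case: (g x.2).
Qed.

Lemma fourier2_tensor f g w :
  cintegrable lebesgue1 f -> cintegrable lebesgue1 g ->
  fourier2 (tensor f g) w = fourier1 f w.1 * fourier1 g w.2.
Proof.
move=> cf cg.
have E (c : R) (A B : R[i]) :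
    c%:C%C * A * (c%:C%C * B) = (c ^+ 2)%:C%C * (A * B).
  by rewrite mulrACA expr2 rmorphM.
rewrite /fourier2 /fourier1 E -cintegral_tensor; [|exact: cintegrable_expi..].
congr (_ * cintegral _ _); apply/funext => x.
by rewrite /tensor opprD expiD mulrACA.
Qed.

Lemma cmod_exprz (z : R[i]) (k : int) : cmod (z ^ k) = cmod z ^ k.
Proof.
have cmodX n : cmod (z ^+ n) = cmod z ^+ n.
  elim: n => [|n IH]; first by rewrite /cmod Normc.normc1.
  by rewrite !exprS cmodM IH.
case: k => n; rewrite ?NegzE -?exprnN -?exprnP ?cmodX//.
by rewrite [LHS]Normc.normcV -/(cmod _) cmodX.
Qed.

Lemma cmod_fourier2_prim k f g w :
  cintegrable lebesgue1 f -> cintegrable lebesgue1 g ->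
  cmod (fourier2_prim k (tensor f g) w) =
  (`|w.1| ^ (- k.1) * cmod (fourier1 f w.1)) *
  (`|w.2| ^ (- k.2) * cmod (fourier1 g w.2)).
Proof.
move=> cf cg; rewrite /fourier2_prim (fourier2_tensor w cf cg) /ipow.
move: (fourier1 f w.1) (fourier1 g w.2) => A B.
have cmod_ipow (x : R) (j : int) : cmod ((0 +i* x)%C ^ j) = `|x| ^ j.
  by rewrite cmod_exprz /cmod /= expr0n add0r sqrtr_sqr.
rewrite -!cmod_ipow.
move: ((0 +i* w.1)%C ^ (- k.1)) ((0 +i* w.2)%C ^ (- k.2)) => U V.
by rewrite !cmodM mulrACA.
Qed.

(** Makes the denominator of [Ckp] the case [k = 0] of its numerator, so that one computation serves
    both. *)
Lemma fourier2_prim0 (h : R * R -> R[i]) : fourier2_prim (0, 0) h = fourier2 h.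
Proof.
by apply/funext => w; rewrite /fourier2_prim /ipow /= oppr0 !expr0z !mul1r.
Qed.

Lemma LpnormC_prim_tensor k p f g :
  measurable_fun setT (cmod \o fourier1 f) ->
  measurable_fun setT (cmod \o fourier1 g) ->
  cintegrable lebesgue1 f -> cintegrable lebesgue1 g ->
  (LpnormC p (fourier2_prim k (tensor f g)) =
   (weighted_int (- k.1) p (cmod \o fourier1 f) *
    weighted_int (- k.2) p (cmod \o fourier1 g)) `^ p^-1)%E.
Proof.
move=> mf mg cf cg; rewrite /LpnormC unlock.
congr (_ `^ _)%E; rewrite /weighted_int -ge0_integral_tensor; first last.
- by move=> x; exact: powR_ge0.
- by move=> x; exact: powR_ge0.
- exact: (measurableT_comp (measurable_powR p) (measurable_weighted _ mg)).
- exact: (measurableT_comp (measurable_powR p) (measurable_weighted _ mf)).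
apply: eq_integral => x _; rewrite /= cmod_fourier2_prim//.
rewrite -powRM ?mulr_ge0 ?exprz_ge0 ?cmod_ge0// ger0_norm//.
by rewrite !mulr_ge0 ?exprz_ge0 ?cmod_ge0.
Qed.

End ComplexTensor.

(** * Limits of the constants *)

Section RatioLimit.
Context {R : realType}.
Implicit Types (p q : R).

(** Finite positive limits make both sequences eventually finite and positive, so the extended
    quotient becomes a real one; finitely many early terms may be infinite. *)
Lemma cvg_poweR_ratio (x y : nat -> \bar R) (lx ly q : R) :
  0 < q -> 0 < lx -> 0 < ly ->
  x n @[n --> \oo] --> lx%:E -> y n @[n --> \oo] --> ly%:E ->
  (x n `^ q / y n `^ q)%E @[n --> \oo] --> ((lx / ly) `^ q)%:E.
Proof.
move=> q0 lx0 ly0 /fine_cvgP[xfin xl] /fine_cvgP[yfin yl].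
have y0 : \forall n \near \oo, 0 < fine (y n) by exact: (cvgr_gt _ yl).
have x0 : \forall n \near \oo, 0 < fine (x n) by exact: (cvgr_gt _ xl).
have powc (u : R^nat) (l : R) : 0 < l -> u n @[n --> \oo] --> l ->
    u n `^ q @[n --> \oo] --> l `^ q.
  move=> l0 ul.
  have cp : (fun x : R => x `^ q) x @[x --> l] --> l `^ q.
    exact: continuous_powR_gt0.
  exact: (cvg_comp u _ ul cp).
rewrite powRM ?invr_ge0 ?(ltW lx0) ?(ltW ly0)//.
have -> : ly^-1 `^ q = (ly `^ q)^-1.
  have lyq : ly `^ q != 0 by rewrite gt_eqF ?powR_gt0.
  apply: (mulfI lyq); rewrite divff// -powRM ?invr_ge0 ?ltW// divff ?powR1//.
  by rewrite gt_eqF.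
apply: (@cvg_trans _
  (((fine (x n) `^ q / fine (y n) `^ q)%:E : \bar R) @[n --> \oo])).
  apply: near_eq_cvg; near=> n.
  have yn : 0 < fine (y n) by near: n.
  rewrite -[x n in RHS]fineK; last by near: n.
  rewrite -[y n in RHS]fineK; last by near: n.
  by rewrite !poweR_EFin inver gt_eqF ?powR_gt0.
apply: cvg_EFin; first exact: nearW.
apply: cvgM; first exact: powc.
by apply: cvgV; [rewrite gt_eqF ?powR_gt0|exact: powc].
Unshelve. all: end_near. Qed.

(** A single [K] serves both functions because their limit profiles live on sets of the same measure
    [2 pi]; it cancels in the quotient. *)
Lemma cvg_Ckp (k : int * int) p (f g : nat -> R -> R[i]) (K L1 L2 : R) :
  0 < p -> 0 < K -> 0 < L1 -> 0 < L2 ->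
  (forall n, cintegrable lebesgue1 (f n)) ->
  (forall n, cintegrable lebesgue1 (g n)) ->
  (forall n, measurable_fun setT (cmod \o fourier1 (f n))) ->
  (forall n, measurable_fun setT (cmod \o fourier1 (g n))) ->
  weighted_int (- k.1) p (cmod \o fourier1 (f n)) @[n --> \oo] --> (K * L1)%:E ->
  weighted_int (- k.2) p (cmod \o fourier1 (g n)) @[n --> \oo] --> (K * L2)%:E ->
  weighted_int 0 p (cmod \o fourier1 (f n)) @[n --> \oo] --> K%:E ->
  weighted_int 0 p (cmod \o fourier1 (g n)) @[n --> \oo] --> K%:E ->
  Ckp k p (tensor (f n) (g n)) @[n --> \oo] --> ((L1 * L2) `^ p^-1)%:E.
Proof.
move=> p0 K0 L10 L20 cf cg mf mg cf1 cg1 cf0 cg0.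
have -> : L1 * L2 = (K * L1 * (K * L2)) / (K * K).
  by field; rewrite gt_eqF.
have CE n : Ckp k p (tensor (f n) (g n)) =
    ((weighted_int (- k.1) p (cmod \o fourier1 (f n)) *
      weighted_int (- k.2) p (cmod \o fourier1 (g n))) `^ p^-1 /
     (weighted_int 0 p (cmod \o fourier1 (f n)) *
      weighted_int 0 p (cmod \o fourier1 (g n))) `^ p^-1)%E.
  by rewrite /Ckp -fourier2_prim0 !LpnormC_prim_tensor//= oppr0.
under eq_fun do rewrite CE.
apply: cvg_poweR_ratio.
- by rewrite invr_gt0.
- by rewrite !mulr_gt0.
- by rewrite mulr_gt0.
- have d : ((K * L1)%:E *? (K * L2)%:E)%E by [].
  rewrite (EFinM (K * L1)); exact: (cvgeM d cf1 cg1).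
- have d : (K%:E *? K%:E)%E by [].
  rewrite (EFinM K); exact: (cvgeM d cf0 cg0).
Qed.

Lemma cvg_weighted_intZ (h : nat -> R -> R[i]) (g : nat -> R -> R) (z : int)
    (p c L : R) :
  0 <= c -> (forall n w, 0 <= g n w) -> (forall n, measurable_fun setT (g n)) ->
  (forall n w, cmod (fourier1 (h n) w) = c * g n w) ->
  weighted_int z p (g n) @[n --> \oo] --> L%:E ->
  weighted_int z p (cmod \o fourier1 (h n)) @[n --> \oo] --> (c `^ p * L)%:E.
Proof.
move=> c0 g0 mg hg gL.
have hE n : weighted_int z p (cmod \o fourier1 (h n)) =
    ((c `^ p)%:E * weighted_int z p (g n))%E.
  rewrite -(weighted_intZl z p c0 (g0 n) (mg n)); congr (weighted_int _ _ _).
  by apply/funext => w; exact: hg.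
under eq_fun do rewrite hE.
by rewrite EFinM; apply: cvgeZl.
Qed.

(* Limits of the [p]-th powers of the one-dimensional factors of [Ckp]. *)
Definition phi_ratio p (k : int) : R := pi `^ (- (p * k%:~R)) / (1 - p * k%:~R).

Definition psi_ratio p (k : int) : R :=
  pi `^ (- (p * k%:~R)) * ((1 - 2 `^ (1 - p * k%:~R)) / (p * k%:~R - 1)).

Lemma phi_ratio_limE p k :
  2 * (pi `^ ((- k)%:~R * p + 1) / ((- k)%:~R * p + 1)) =
  2 * pi * phi_ratio p k.
Proof.
have -> : (- k)%:~R * p + 1 = 1 - p * k%:~R :> R by rewrite mulrNz; ring.
rewrite /phi_ratio powRD; last by rewrite (gt_eqF (pi_gt0 R)) implybT.
by rewrite powRr1 ?pi_ge0//; ring.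
Qed.

Lemma psi_ratio_limE p k : 1 - p * k%:~R != 0 ->
  2 * (((pi * 2) `^ ((- k)%:~R * p + 1) - pi `^ ((- k)%:~R * p + 1)) /
       ((- k)%:~R * p + 1)) = 2 * pi * psi_ratio p k.
Proof.
have -> : (- k)%:~R * p + 1 = 1 - p * k%:~R :> R by rewrite mulrNz; ring.
move=> s0; rewrite /psi_ratio powRM ?pi_ge0//.
rewrite (@powRD _ pi); last by rewrite (gt_eqF (pi_gt0 R)) implybT.
rewrite powRr1 ?pi_ge0// -(opprB 1); field.
by rewrite s0.
Qed.

Lemma phi_ratio_gt0 p k : 0 <= p -> k <= 0 -> 0 < phi_ratio p k.
Proof.
move=> p0 k0; rewrite /phi_ratio divr_gt0 ?powR_gt0 ?pi_gt0//.
by rewrite subr_gt0 (le_lt_trans _ ltr01)// mulr_ge0_le0// lerz0.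
Qed.

Lemma psi_ratio_gt0 p k : 1 < p -> 0 < k -> 0 < psi_ratio p k.
Proof.
move=> p1 k0; have pk : 1 < p * k%:~R.
  by rewrite (lt_le_trans p1)// ler_peMr ?(ltW (lt_trans ltr01 p1))// ler1z.
rewrite /psi_ratio mulr_gt0 ?powR_gt0 ?pi_gt0// divr_gt0 ?subr_gt0//.
rewrite -opprB powRN invf_lt1 ?powR_gt0//.
have : 1 `^ (p * k%:~R - 1) < 2 `^ (p * k%:~R - 1) :> R.
  by apply: gt0_ltr_powR; rewrite ?nnegrE ?subr_gt0 ?ltr1n.
by rewrite powR1.
Qed.

Lemma powR_pi_ratio p (k : int) (x : R) : p != 0 -> 0 <= x ->
  (pi `^ (- (p * k%:~R)) * x) `^ p^-1 = pi ^ (- k) * x `^ p^-1.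
Proof.
move=> p0 x0; rewrite powRM ?powR_ge0//; congr (_ * _).
rewrite -powRrM mulNr mulrAC divff// mul1r -powR_intmul ?pi_ge0//.
by rewrite mulrNz.
Qed.

End RatioLimit.

(** * The three limits for Daubechies families, up to rewriting the constants *)

Section DaubechiesLimits.
Context {R : realType}.
Variables (p : R) (H phi psi : nat -> R -> R[i]).
Hypothesis p1 : 1 < p.
Hypothesis maskH : forall m, (0 < m)%N -> is_daubechies_mask m (H m).
Hypothesis scalingH : forall m, (0 < m)%N -> is_scaling_function (H m) (phi m).
Hypothesis waveletH : forall m, (0 < m)%N -> is_wavelet (H m) (psi m).

Let c : R := (Num.sqrt (2 * pi))^-1.
Let K : R := c `^ p * (2 * pi).

Let c_gt0 : 0 < c.
Proof. by rewrite invr_gt0 sqrtr_gt0 mulr_gt0 ?pi_gt0. Qed.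

Let K_gt0 : 0 < K.
Proof. by rewrite mulr_gt0 ?powR_gt0// mulr_gt0 ?pi_gt0. Qed.

Lemma cmod_fourier1_phi n w : cmod (fourier1 (phi n.+1) w) = c * phi_abs n w.
Proof. by rewrite (cmod_fourier1_scaling (maskH _) _ (scalingH _)). Qed.

Lemma cmod_fourier1_psi n w : cmod (fourier1 (psi n.+1) w) = c * psi_abs n w.
Proof. by rewrite (cmod_fourier1_wavelet (maskH _) _ (waveletH _)). Qed.

Lemma measurable_fourier1_phi n :
  measurable_fun setT (cmod \o fourier1 (phi n.+1)).
Proof.
have -> : cmod \o fourier1 (phi n.+1) = (fun w => c * phi_abs n w).
  by apply/funext => w; exact: cmod_fourier1_phi.
by apply: measurable_funM => //; exact: measurable_phi_abs.
Qed.

Lemma measurable_fourier1_psi n :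
  measurable_fun setT (cmod \o fourier1 (psi n.+1)).
Proof.
have -> : cmod \o fourier1 (psi n.+1) = (fun w => c * psi_abs n w).
  by apply/funext => w; exact: cmod_fourier1_psi.
by apply: measurable_funM => //; exact: measurable_psi_abs.
Qed.

Lemma cvg_weighted_fourier_phi k : k <= 0 ->
  weighted_int (- k) p (cmod \o fourier1 (phi n.+1)) @[n --> \oo] -->
  (K * phi_ratio p k)%:E.
Proof.
move=> k0; have kN0 : 0 <= - k by rewrite oppr_ge0.
have := cvg_weighted_int_phi (ltW p1) kN0; rewrite phi_ratio_limE => cv.
rewrite /K -mulrA.
exact: (cvg_weighted_intZ (ltW c_gt0) (@phi_abs_ge0 R) (@measurable_phi_abs R)
  cmod_fourier1_phi cv).
Qed.

Lemma cvg_weighted_fourier_psi k : 0 <= k ->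
  weighted_int (- k) p (cmod \o fourier1 (psi n.+1)) @[n --> \oo] -->
  (K * psi_ratio p k)%:E.
Proof.
move=> k0; have kN0 : - k <= 0 by rewrite oppr_le0.
(* A positive integer [k] has [p k > 1], so the logarithmic case of the power integral never
   occurs. *)
have s0 : 1 - p * k%:~R != 0.
  move: k0; rewrite le_eqVlt => /predU1P[<-|k0].
    by rewrite mulr0 subr0 oner_eq0.
  rewrite lt_eqF// subr_lt0 (lt_le_trans p1)// ler_peMr ?ler1z//.
  exact: ltW (lt_trans ltr01 p1).
have s0' : (- k)%:~R * p + 1 != 0 by rewrite mulrNz mulNr addrC mulrC.
have := cvg_weighted_int_psi (ltW p1) kN0 s0'.
rewrite (psi_ratio_limE s0) => cv.
rewrite /K -mulrA.
exact: (cvg_weighted_intZ (ltW c_gt0) (@psi_abs_ge0 R) (@measurable_psi_abs R)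
  cmod_fourier1_psi cv).
Qed.

Let phi_ratio0 : phi_ratio p 0 = 1 :> R.
Proof. by rewrite /phi_ratio !mulr0 oppr0 powRr0 addr0 divr1. Qed.

Let psi_ratio0 : psi_ratio p 0 = 1 :> R.
Proof.
rewrite /psi_ratio !mulr0 oppr0 powRr0 addr0 add0r powRr1// mul1r.
by rewrite invrN1 mulrN1 opprB (_ : 2 = 1 + 1)// addrK.
Qed.

Lemma cvg_weighted_fourier_phi0 :
  weighted_int 0 p (cmod \o fourier1 (phi n.+1)) @[n --> \oo] --> K%:E.
Proof.
by have := cvg_weighted_fourier_phi (lexx 0); rewrite phi_ratio0 mulr1 oppr0.
Qed.

Lemma cvg_weighted_fourier_psi0 :
  weighted_int 0 p (cmod \o fourier1 (psi n.+1)) @[n --> \oo] --> K%:E.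
Proof.
by have := cvg_weighted_fourier_psi (lexx 0); rewrite psi_ratio0 mulr1 oppr0.
Qed.

Let p_gt0 : 0 < p. Proof. exact: lt_trans ltr01 p1. Qed.

Let cphi n : cintegrable lebesgue1 (phi n.+1).
Proof. by case: (scalingH (ltn0Sn n)). Qed.

Let cpsi n : cintegrable lebesgue1 (psi n.+1).
Proof. by case: (waveletH (ltn0Sn n)). Qed.

Lemma cvg_Ckp_psi_phi k1 k2 : 0 < k1 -> k2 <= 0 ->
  Ckp (k1, k2) p (tensor (psi n) (phi n)) @[n --> \oo] -->
  ((psi_ratio p k1 * phi_ratio p k2) `^ p^-1)%:E.
Proof.
move=> k1_gt0 k2_le0.
(* The order 0, about which the hypotheses say nothing, is dropped; [dmask n] belongs to order
   [n.+1]. *)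
rewrite -(cvg_shiftS (fun n => Ckp (k1, k2) p (tensor (psi n) (phi n)))).
apply: (cvg_Ckp p_gt0 K_gt0 (psi_ratio_gt0 p1 k1_gt0)
  (phi_ratio_gt0 (ltW p_gt0) k2_le0) cpsi cphi
  measurable_fourier1_psi measurable_fourier1_phi).
- exact: cvg_weighted_fourier_psi (ltW k1_gt0).
- exact: cvg_weighted_fourier_phi k2_le0.
- exact: cvg_weighted_fourier_psi0.
- exact: cvg_weighted_fourier_phi0.
Qed.

Lemma cvg_Ckp_phi_psi k1 k2 : k1 <= 0 -> 0 < k2 ->
  Ckp (k1, k2) p (tensor (phi n) (psi n)) @[n --> \oo] -->
  ((phi_ratio p k1 * psi_ratio p k2) `^ p^-1)%:E.
Proof.
move=> k1_le0 k2_gt0.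
rewrite -(cvg_shiftS (fun n => Ckp (k1, k2) p (tensor (phi n) (psi n)))).
apply: (cvg_Ckp p_gt0 K_gt0 (phi_ratio_gt0 (ltW p_gt0) k1_le0)
  (psi_ratio_gt0 p1 k2_gt0) cphi cpsi
  measurable_fourier1_phi measurable_fourier1_psi).
- exact: cvg_weighted_fourier_phi k1_le0.
- exact: cvg_weighted_fourier_psi (ltW k2_gt0).
- exact: cvg_weighted_fourier_phi0.
- exact: cvg_weighted_fourier_psi0.
Qed.

Lemma cvg_Ckp_psi_psi k1 k2 : 0 < k1 -> 0 < k2 ->
  Ckp (k1, k2) p (tensor (psi n) (psi n)) @[n --> \oo] -->
  ((psi_ratio p k1 * psi_ratio p k2) `^ p^-1)%:E.
Proof.
move=> k1_gt0 k2_gt0.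
rewrite -(cvg_shiftS (fun n => Ckp (k1, k2) p (tensor (psi n) (psi n)))).
apply: (cvg_Ckp p_gt0 K_gt0 (psi_ratio_gt0 p1 k1_gt0) (psi_ratio_gt0 p1 k2_gt0)
  cpsi cpsi measurable_fourier1_psi measurable_fourier1_psi).
- exact: cvg_weighted_fourier_psi (ltW k1_gt0).
- exact: cvg_weighted_fourier_psi (ltW k2_gt0).
- exact: cvg_weighted_fourier_psi0.
- exact: cvg_weighted_fourier_psi0.
Qed.

End DaubechiesLimits.

Lemma phi_ratio_root (R : realType) (p : R) (k : int) : 0 < p -> k <= 0 ->
  phi_ratio p k `^ p^-1 = pi ^ (- k) / (1 - p * k%:~R) `^ p^-1.
Proof.
move=> p0 k0; have s0 : 0 < 1 - p * k%:~R.
  by rewrite subr_gt0 (le_lt_trans _ ltr01)// mulr_ge0_le0 ?lerz0// ltW.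
rewrite /phi_ratio powR_pi_ratio ?gt_eqF ?invr_ge0 ?(ltW s0)//; congr (_ * _).
have sp : (1 - p * k%:~R) `^ p^-1 != 0 by rewrite gt_eqF ?powR_gt0.
apply: (mulfI sp); rewrite divff// -powRM ?invr_ge0 ?(ltW s0)//.
by rewrite divff ?powR1// gt_eqF.
Qed.

Lemma psi_quot_ge0 (R : realType) (p : R) (k : int) : 1 < p -> 0 < k ->
  0 <= (1 - 2 `^ (1 - p * k%:~R)) / (p * k%:~R - 1).
Proof.
move=> p1 k0; have := psi_ratio_gt0 p1 k0.
by rewrite /psi_ratio pmulr_rgt0 ?powR_gt0 ?pi_gt0//; exact: ltW.
Qed.

Lemma psi_ratio_root (R : realType) (p : R) (k : int) : 1 < p -> 0 < k ->
  psi_ratio p k `^ p^-1 =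
  pi ^ (- k) * ((1 - 2 `^ (1 - p * k%:~R)) / (p * k%:~R - 1)) `^ p^-1.
Proof.
move=> p1 k0; rewrite /psi_ratio powR_pi_ratio ?psi_quot_ge0//.
by rewrite gt_eqF// (lt_trans ltr01).
Qed.

(** As [1 / p < 1], the borderline [k = 1 / p] is never an integer, and the denominator [1 - p k] is
    at least 1. *)
Lemma intr_le_inv_le0 (R : realType) (p : R) (k : int) : 1 < p ->
  k%:~R <= p^-1 -> k <= 0.
Proof.
move=> p1 kp; rewrite -ltzD1 add0r -(ltrz1 R) (le_lt_trans kp)// invf_lt1//.
exact: lt_trans ltr01 p1.
Qed.

Theorem corollary9 (R : realType) (p : R) (H phi psi : nat -> R -> complex R)
  (k1 k2 : int) :
  1 < p ->
  (forall m : nat, (0 < m)%N -> is_daubechies_mask m (H m)) ->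
  (forall m : nat, (0 < m)%N -> is_scaling_function (H m) (phi m)) ->
  (forall m : nat, (0 < m)%N -> is_wavelet (H m) (psi m)) ->
  [/\ k2%:~R <= p^-1 -> 0 < k1 ->
        Ckp (k1, k2) p (tensor (psi m) (phi m)) @[m --> \oo] -->
        (pi ^ (- k1)
         * ((1 - 2 `^ (1 - p * k1%:~R)) / (p * k1%:~R - 1)) `^ p^-1
         * (pi ^ (- k2) / (1 - p * k2%:~R) `^ p^-1))%:E,
      k1%:~R <= p^-1 -> 0 < k2 ->
        Ckp (k1, k2) p (tensor (phi m) (psi m)) @[m --> \oo] -->
        (pi ^ (- k2)
         * ((1 - 2 `^ (1 - p * k2%:~R)) / (p * k2%:~R - 1)) `^ p^-1
         * (pi ^ (- k1) / (1 - p * k1%:~R) `^ p^-1))%:E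
    & 0 < k1 -> 0 < k2 ->
        Ckp (k1, k2) p (tensor (psi m) (psi m)) @[m --> \oo] -->
        (pi ^ (- k1 - k2)
         * ((1 - 2 `^ (1 - p * k1%:~R)) / (p * k1%:~R - 1)
            * ((1 - 2 `^ (1 - p * k2%:~R)) / (p * k2%:~R - 1))) `^ p^-1)%:E].
Proof.
move=> p1 maskH scalingH waveletH.
have p0 : 0 < p := lt_trans ltr01 p1.
split.
- move=> /(intr_le_inv_le0 p1) k2_le0 k1_gt0.
  rewrite -(psi_ratio_root p1 k1_gt0) -(phi_ratio_root p0 k2_le0) -powRM.
  + exact: cvg_Ckp_psi_phi p1 maskH scalingH waveletH k1 k2 k1_gt0 k2_le0.
  + exact: ltW (psi_ratio_gt0 p1 k1_gt0).
  + exact: ltW (phi_ratio_gt0 (ltW p0) k2_le0).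
- move=> /(intr_le_inv_le0 p1) k1_le0 k2_gt0.
  rewrite -(psi_ratio_root p1 k2_gt0) -(phi_ratio_root p0 k1_le0) mulrC -powRM.
  + exact: cvg_Ckp_phi_psi p1 maskH scalingH waveletH k1 k2 k1_le0 k2_gt0.
  + exact: ltW (phi_ratio_gt0 (ltW p0) k1_le0).
  + exact: ltW (psi_ratio_gt0 p1 k2_gt0).
- move=> k1_gt0 k2_gt0.
  have piE : pi ^ (- k1 - k2) = pi ^ (- k1) * pi ^ (- k2) :> R.
    by rewrite expfzDr// gt_eqF ?pi_gt0.
  rewrite piE powRM ?psi_quot_ge0// mulrACA.
  rewrite -(psi_ratio_root p1 k1_gt0) -(psi_ratio_root p1 k2_gt0) -powRM.
  + exact: cvg_Ckp_psi_psi p1 maskH waveletH k1 k2 k1_gt0 k2_gt0.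
  + exact: ltW (psi_ratio_gt0 p1 k1_gt0).
  + exact: ltW (psi_ratio_gt0 p1 k2_gt0).
Qed.
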